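(* Let $\mathbb{M}=\langle M,\mathcal{C}\rangle$ be a countable transitive model of $\mathsf{GB}^-$ and let $\mathbb{P}$ be a notion of class forcing for $\mathbb{M}$. If $\mathbb{P}$ is approachable by projections, then the forcing relation for ''$v_0=v_1$'' is definable, i.e. $\{\langle p,\sigma,\tau\rangle\in P\times M^{\mathbb{P}}\times M^{\mathbb{P}}\mid p\Vdash^{\mathbb{M}}_{\mathbb{P}}\sigma=\tau\}\in\mathcal{C}$. Therefore, $\mathbb{P}$ satisfies the forcing theorem over $\mathbb{M}$ for every $\mathcal{L}^n$-formula (for every $n<\omega$).
   Context: We work in a model $\mathsf{V}$ of $\mathsf{ZFC}$. $\mathsf{ZF}^-$ is $\mathsf{ZF}$ without power set and with Collection instead of Replacement. $\mathsf{GB}^-$ is the two-sorted theory (sets and classes) whose set axioms are those of $\mathsf{ZF}^-$ with class parameters allowed in Separation and Collection and whose class axioms are extensionality, foundation and first-order class comprehension (only set quantifiers). A countable transitive model of $\mathsf{GB}^-$ is a model $\mathbb{M}=\langle M,\mathcal{C}\rangle$ of $\mathsf{GB}^-$ (sets: $M$; classes: $\mathcal{C}\subseteq\mathcal{P}(M)$) with $M$ transitive and $M,\mathcal{C}$ countable in $\mathsf{V}$. A notion of class forcing for $\mathbb{M}$ is a preorder $\mathbb{P}=\langle P,\leq_{\mathbb{P}}\rangle$ with largest element $1_{\mathbb{P}}$ and $P,\leq_{\mathbb{P}}\in\mathcal{C}$; it is a notion of set forcing if it is an element of $M$. $\mathbb{P}$ is approachable by projections if it can be written as a continuous, increasing union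 $\mathbb{P}=\bigcup_{\alpha\in\mathrm{Ord}^M}\mathbb{P}_\alpha$ for a sequence $\langle\mathbb{P}_\alpha\mid\alpha\in\mathrm{Ord}^M\rangle\in\mathcal{C}$ of notions of set forcing $\mathbb{P}_\alpha=\langle P_\alpha,\leq_{\mathbb{P}_\alpha}\rangle$, where $\leq_{\mathbb{P}_\alpha}$ is the ordering on $P_\alpha$ induced by $\mathbb{P}$, for which there is a sequence of maps $\langle\pi_{\alpha+1}\mid\alpha\in\mathrm{Ord}^M\rangle$ with $\pi_{\alpha+1}:P\to P_{\alpha+1}$, $\{\langle\alpha,p,\pi_{\alpha+1}(p)\rangle\mid\alpha\in\mathrm{Ord}^M,\ p\in P\}\in\mathcal{C}$, and such that for every $\alpha\in\mathrm{Ord}^M$: (1) $\pi_{\alpha+1}(1_{\mathbb{P}})=1_{\mathbb{P}}$; (2) for all $p,q\in P$, if $p\leq_{\mathbb{P}}q$ then $\pi_{\alpha+1}(p)\leq_{\mathbb{P}}\pi_{\alpha+1}(q)$; (3) for all $p\in P$ and all $q\leq_{\mathbb{P}_{\alpha+1}}\pi_{\alpha+1}(p)$ there is $r\leq_{\mathbb{P}}p$ with $\pi_{\alpha+1}(r)\leq_{\mathbb{P}}q$; (4) for all $p\in P_\alpha$ and $q\in P$, if $\pi_{\alpha+1}(q)\leq_{\mathbb{P}}p$ then $q\leq_{\mathbb{P}}p$; (5) $\pi_{\alpha+1}$ is the identity on $P_\alpha$. A $\mathbb{P}$-name is an object all of whose elements are of the form $\langle\tau,p\rangle$ with $\tau$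 a $\mathbb{P}$-name and $p\in\mathbb{P}$; $M^{\mathbb{P}}$ (resp. $\mathcal{C}^{\mathbb{P}}$) is the set of $\mathbb{P}$-names in $M$ (resp. $\mathcal{C}$). A filter $G$ on $\mathbb{P}$ is $\mathbb{P}$-generic over $\mathbb{M}$ if it meets every dense subset of $\mathbb{P}$ in $\mathcal{C}$. Put $\sigma^G=\{\tau^G\mid\exists p\in G\ \langle\tau,p\rangle\in\sigma\}$ and $M[G]=\{\sigma^G\mid\sigma\in M^{\mathbb{P}}\}$. $\mathcal{L}^n$ is the language of set theory extended by $n$ unary predicate symbols. For an $\mathcal{L}^n$-formula $\varphi(v_0,\ldots,v_{m-1})$, $\vec\Gamma\in(\mathcal{C}^{\mathbb{P}})^n$, $p\in P$, $\sigma_i\in M^{\mathbb{P}}$, write $p\Vdash^{\mathbb{M},\vec\Gamma}_{\mathbb{P}}\varphi(\sigma_0,\ldots,\sigma_{m-1})$ if $\varphi(\sigma_0^G,\ldots,\sigma_{m-1}^G)$ holds in $M_{\vec\Gamma}[G]=\langle M[G],\in,\Gamma_0^G,\ldots,\Gamma_{n-1}^G\rangle$ for every $\mathbb{P}$-generic $G$ over $\mathbb{M}$ with $p\in G$. $\mathbb{P}$ satisfies the forcing theorem for $\varphi$ over $\mathbb{M}$ if (definability lemma) for all $\vec\Gamma$, $\{\langle p,\vec\sigma\rangle\mid p\Vdash^{\mathbb{M},\vec\Gamma}_{\mathbb{P}}\varphi(\vec\sigma)\}\in\mathcal{C}$, and (truth lemma) for all $\vec\sigma,\vec\Gamma$ and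 all $\mathbb{P}$-generic $G$ with $M_{\vec\Gamma}[G]\models\varphi(\vec\sigma^G)$ there is $p\in G$ with $p\Vdash^{\mathbb{M},\vec\Gamma}_{\mathbb{P}}\varphi(\vec\sigma)$. *)

(* Defs.v *)
(* The ambient universe of sets is the type [V] of iterative sets built from a
   Rocq universe, quotiented by bisimilarity so that extensional equality is
   Leibniz equality.  Membership on [V] is well-founded, and [V] is a model of
   ZFC (lemmas [V_extensionality] to [V_choice]).  Natural numbers and formulas
   of [V] are standard, so they are rendered by [nat] and by a Rocq inductive
   type. *)
From HB Require Import structures.
From mathcomp Require Import all_boot generic_quotient.
From mathcomp Require Import boolp classical_sets functions cardinality.

Set Implicit Arguments.
Unset Strict Implicit.
Unset Printing Implicit Defensive.

Declare Scope zf_scope.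
Delimit Scope zf_scope with zf.
Local Open Scope quotient_scope.
Local Open Scope zf_scope.

Inductive pset : Type := Pset (I : Type) (f : I -> pset).

Definition pidx (x : pset) : Type := let: Pset J _ := x in J.

Definition pelt (x : pset) : pidx x -> pset :=
  match x return pidx x -> pset with Pset _ f => f end.

Fixpoint peq (x y : pset) : Prop :=
  match x, y with
  | Pset J f, Pset K g =>
      (forall i, exists j, peq (f i) (g j)) /\
      (forall j, exists i, peq (f i) (g j))
  end.

Lemma peq_refl x : peq x x.
Proof. by elim: x => I f IH /=; split=> i; exists i. Qed.

Lemma peq_sym x y : peq x y -> peq y x.
Proof.
elim: x y => I f IH [J g] /= [H1 H2]; split.
- by move=> j; have [i Hi] := H2 j; exists i; apply: IH.
- by move=> i; have [j Hj] := H1 i; exists j; apply: IH.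
Qed.

Lemma peq_trans y x z : peq x y -> peq y z -> peq x z.
Proof.
elim: x y z => I f IH [J g] [K h] /= [H1 H2] [H3 H4]; split.
- move=> i; have [j Hj] := H1 i; have [k Hk] := H3 j.
  by exists k; apply: IH Hj Hk.
- move=> k; have [j Hj] := H4 k; have [i Hi] := H2 j.
  by exists i; apply: IH Hi Hj.
Qed.

HB.instance Definition _ := gen_eqMixin pset.
HB.instance Definition _ := gen_choiceMixin pset.

Definition peqb (x y : pset) : bool := `[< peq x y >].

Lemma peqb_equiv : equiv_class_of peqb.
Proof.
split.
- by move=> x; apply/asboolP/peq_refl.
- by move=> x y; apply/asboolP/asboolP => /peq_sym.
- move=> y x z /asboolP Hxy /asboolP Hyz; apply/asboolP.
  exact: peq_trans Hxy Hyz.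
Qed.

Canonical peq_rel := EquivRelPack peqb_equiv.

Definition V : Type := {eq_quot peq_rel}.

Definition idx (x : V) : Type := pidx (repr x).

Definition elt (x : V) (i : idx x) : V := \pi_({eq_quot peq_rel}) (pelt i).

Definition mem (z x : V) : Prop := exists i : idx x, z = elt i.

Notation "z ∈ x" := (mem z x) (at level 70, no associativity) : zf_scope.

Definition subset (x y : V) : Prop := forall z, z ∈ x -> z ∈ y.

Notation "x ⊆ y" := (subset x y) (at level 70, no associativity) : zf_scope.

Definition mk (I : Type) (f : I -> V) : V :=
  \pi_({eq_quot peq_rel}) (Pset (fun i => repr (f i))).

Lemma pi_eqP (a b : pset) :
  \pi_({eq_quot peq_rel}) a = \pi_({eq_quot peq_rel}) b <-> peq a b.
Proof.
split=> [H|H].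
- by have /eqmodP/asboolP := H.
- by apply/eqmodP/asboolP.
Qed.

Lemma repr_pi (a : pset) : peq (repr (\pi_({eq_quot peq_rel}) a)) a.
Proof. by apply/pi_eqP; rewrite reprK. Qed.

Lemma mem_pi (z : V) (a : pset) :
  z ∈ (\pi_({eq_quot peq_rel}) a : V) <->
  exists i, z = \pi_({eq_quot peq_rel}) (@pelt a i).
Proof.
rewrite /mem /idx /elt; move: (repr_pi a).
case: (repr _) => I f; case: a => J g /= [H1 H2]; split.
- by move=> [i ->]; have [j Hj] := H1 i; exists j; apply/pi_eqP.
- move=> [j ->]; have [i Hi] := H2 j; exists i.
  by apply/pi_eqP/peq_sym.
Qed.

Lemma in_mk (I : Type) (f : I -> V) (z : V) :
  z ∈ mk f <-> exists i, z = f i.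
Proof.
rewrite /mk; split.
- by move=> /mem_pi [i ->]; exists i; rewrite /= reprK.
- by move=> [i ->]; apply/mem_pi; exists i; rewrite /= reprK.
Qed.

Lemma V_extensionality (x y : V) : (forall z, z ∈ x <-> z ∈ y) -> x = y.
Proof.
move=> H; rewrite -[x]reprK -[y]reprK; apply/pi_eqP.
move: H; rewrite /mem /idx /elt.
case: (repr x) (repr y) => [I f] [J g] /= H; split.
- move=> i; have [|j Hj] := (H (\pi_({eq_quot peq_rel}) (f i))).1.
    by exists i.
  by exists j; apply/pi_eqP.
- move=> j; have [|i Hi] := (H (\pi_({eq_quot peq_rel}) (g j))).2.
    by exists j.
  by exists i; apply/pi_eqP.
Qed.

Lemma V_foundation : well_founded mem.
Proof.
move=> x; rewrite -[x]reprK; elim: (repr x) => I f IH.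
by constructor=> z /mem_pi [i ->].
Qed.

Lemma mem_elt (x : V) (i : idx x) : elt i ∈ x.
Proof. by exists i. Qed.

Lemma memP (z x : V) : z ∈ x <-> exists i : idx x, z = elt i.
Proof. by []. Qed.

Definition empty : V := mk (fun i : void => match i with end).
Definition upair (x y : V) : V := mk (fun b : bool => if b then x else y).
Definition union (x : V) : V :=
  mk (fun i : {i : idx x & idx (elt i)} => elt (projT2 i)).
Definition sep (x : V) (Q : V -> Prop) : V :=
  mk (fun i : {i : idx x | Q (elt i)} => elt (proj1_sig i)).
Definition image (f : V -> V) (x : V) : V := mk (fun i : idx x => f (elt i)).
Definition power (x : V) : V :=
  mk (fun S : idx x -> Prop => mk (fun i : {i : idx x | S i} => elt (proj1_sig i))).

Lemma in_empty z : ~ z ∈ empty.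
Proof. by move=> /in_mk [[]]. Qed.

Lemma in_upair x y z : z ∈ upair x y <-> z = x \/ z = y.
Proof.
split; first by move=> /in_mk [[] ->]; [left|right].
by move=> [] ->; apply/in_mk; [exists true|exists false].
Qed.

Lemma in_union x z : z ∈ union x <-> exists y, y ∈ x /\ z ∈ y.
Proof.
split.
- move=> /in_mk [[i j] ->]; exists (elt i).
  by split; [exists i|exists j].
- by move=> [y [[i ->] [j ->]]]; apply/in_mk; exists (existT _ i j).
Qed.

Lemma in_sep x (Q : V -> Prop) z : z ∈ sep x Q <-> z ∈ x /\ Q z.
Proof.
split.
- by move=> /in_mk [[i Hi] ->]; split=> //; exists i.
- by move=> [[i ->] Hi]; apply/in_mk; exists (exist _ i Hi).
Qed.

Lemma in_image (f : V -> V) x z : z ∈ image f x <-> exists y, y ∈ x /\ z = f y.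
Proof.
split.
- by move=> /in_mk [i ->]; exists (elt i); split=> //; exists i.
- by move=> [y [[i ->] ->]]; apply/in_mk; exists i.
Qed.

Lemma in_power x z : z ∈ power x <-> z ⊆ x.
Proof.
split.
- by move=> /in_mk [S ->] w /in_mk [[i Hi] ->]; exists i.
- move=> zx; apply/in_mk; exists (fun i => elt i ∈ z).
  apply: V_extensionality => w; split.
  + move=> wz; have [i wi] := zx _ wz; subst w.
    by apply/in_mk; exists (exist _ i wz).
  + by move=> /in_mk [[i Hi] ->].
Qed.

(* Prevents unification from unfolding the quotient construction. *)
#[global] Opaque mem mk empty upair union sep image power.

Definition succ (x : V) : V := union (upair x (upair x x)).

Lemma in_succ x z : z ∈ succ x <-> z ∈ x \/ z = x.
Proof.
split.
- move=> /in_union [y [/in_upair [->|->] Hz]]; first by left.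
  by move/in_upair: Hz => [] ->; right.
- move=> [Hz|->]; apply/in_union.
  + by exists x; split=> //; apply/in_upair; left.
  + by exists (upair x x); split; apply/in_upair; [right|left].
Qed.

Lemma V_infinity :
  exists x, empty ∈ x /\ forall y, y ∈ x -> succ y ∈ x.
Proof.
exists (mk (fun n : nat => iter n succ empty)); split.
- by apply/in_mk; exists 0.
- by move=> y /in_mk [n ->]; apply/in_mk; exists n.+1.
Qed.

Lemma V_replacement (x : V) (R : V -> V -> Prop) :
  (forall y, y ∈ x -> exists! z, R y z) ->
  exists b, forall z, z ∈ b <-> exists y, y ∈ x /\ R y z.
Proof.
move=> HR.
have [f Hf] : exists f : V -> V, forall y, y ∈ x -> R y (f y).
  suff /choice [f Hf] : forall y, exists z, y ∈ x -> R y z by exists f.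
  move=> y.
  have [yx|nyx] := pselect (y ∈ x); last by exists y.
  by have [z [Rz _]] := HR y yx; exists z.
exists (image f x) => z; split.
- by move=> /in_image [y [yx ->]]; exists y; split=> //; apply: Hf.
- move=> [y [yx Ryz]]; apply/in_image; exists y; split=> //.
  have [w [_ Hw]] := HR y yx.
  by rewrite -(Hw _ Ryz) -(Hw _ (Hf _ yx)).
Qed.

Lemma V_choice (x : V) :
  (forall y, y ∈ x -> exists z, z ∈ y) ->
  (forall y y' z, y ∈ x -> y' ∈ x -> z ∈ y -> z ∈ y' -> y = y') ->
  exists c, forall y, y ∈ x -> exists! z, z ∈ y /\ z ∈ c.
Proof.
move=> ne disj.
have [f Hf] : exists f : V -> V, forall y, y ∈ x -> f y ∈ y.
  suff /choice [f Hf] : forall y, exists z, y ∈ x -> z ∈ y by exists f.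
  move=> y.
  have [yx|nyx] := pselect (y ∈ x); last by exists y.
  by have [z Hz] := ne y yx; exists z.
exists (image f x) => y yx; exists (f y); split.
- by split; [exact: Hf|apply/in_image; exists y].
- move=> z [zy /in_image [y' [y'x zE]]]; rewrite zE; congr f.
  by apply: (disj _ _ (f y')) => //; [rewrite -zE|exact: Hf].
Qed.

Definition opair (x y : V) : V := upair (upair x x) (upair x y).

Lemma upair_inj x y z : upair x y = upair x z -> y = z.
Proof.
move=> H.
have /in_upair [yx|//] : y ∈ upair x z by rewrite -H; apply/in_upair; right.
have /in_upair [zx|->//] : z ∈ upair x y by rewrite H; apply/in_upair; right.
by rewrite yx zx.
Qed.

Lemma opair_inj x y x' y' : opair x y = opair x' y' -> x = x' /\ y = y'.
Proof.
move=> H.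
have xx' : x = x'.
  have : upair x x ∈ opair x' y' by rewrite -H; apply/in_upair; left.
  move=> /in_upair [E|E].
  - have /in_upair [] // : x ∈ upair x' x' by rewrite -E; apply/in_upair; left.
  - have : x' ∈ upair x x by rewrite E; apply/in_upair; left.
    by move=> /in_upair [].
by subst x'; split=> //; apply: (upair_inj (x := x)); apply: (upair_inj H).
Qed.

(* [tup x [:: y_1; ..; y_k]] is the tuple (x, (y_1, (.., y_k))); the
   one-element tuple is the element itself. *)
Fixpoint tup (x : V) (s : seq V) : V :=
  if s is y :: s' then opair x (tup y s') else x.

Definition transitive_set (x : V) : Prop := forall y, y ∈ x -> y ⊆ x.

Definition ordinal_set (x : V) : Prop :=
  [/\ transitive_set x,
      forall y, y ∈ x -> ~ y ∈ y,
      forall y z w, y ∈ x -> z ∈ x -> w ∈ x -> y ∈ z -> z ∈ w -> y ∈ w,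
      forall y z, y ∈ x -> z ∈ x -> [\/ y ∈ z, y = z | z ∈ y] &
      forall u, u ⊆ x -> (exists y, y ∈ u) ->
        exists y, y ∈ u /\ forall z, z ∈ u -> ~ z ∈ y].

Definition limit_set (x : V) : Prop :=
  [/\ ordinal_set x, x <> empty & forall y, y ∈ x -> succ y ∈ x].

(* Ord^M; being an ordinal is absolute for transitive models. *)
Definition in_Ord (M a : V) : Prop := a ∈ M /\ ordinal_set a.

Definition countable_set (x : V) : Prop := countable [set z : V | z ∈ x].

(* [form n m] is the type of L^n-formulas all of whose free variables are among
   v_0, .., v_{m-1}.  In [fAll f] the bound variable is the variable 0 of [f],
   the other variables being shifted by one.  The remaining connectives are
   classically definable. *)
Inductive form (n : nat) : nat -> Type :=
| fEq m (i j : 'I_m) : form n m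
| fMem m (i j : 'I_m) : form n m
| fPred m (k : 'I_n) (i : 'I_m) : form n m
| fNot m (f : form n m) : form n m
| fAnd m (f g : form n m) : form n m
| fAll m (f : form n m.+1) : form n m.

Arguments fEq {n m} i j.
Arguments fMem {n m} i j.
Arguments fPred {n m} k i.

(* Satisfaction in the structure (D, ∈, A_0, .., A_{n-1}). *)
Fixpoint sat (D : V) (n : nat) (A : n.-tuple V) (m : nat) (f : form n m) :
    m.-tuple V -> Prop :=
  match f in form _ m return m.-tuple V -> Prop with
  | fEq _ i j => fun e => tnth e i = tnth e j
  | fMem _ i j => fun e => tnth e i ∈ tnth e j
  | fPred _ k i => fun e => tnth e i ∈ tnth A k
  | fNot _ f => fun e => ~ sat D A f e
  | fAnd _ f g => fun e => sat D A f e /\ sat D A g e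
  | fAll _ f => fun e => forall x, x ∈ D -> sat D A f [tuple of x :: e]
  end.

Definition all_in (m : nat) (e : m.-tuple V) (x : V) : Prop :=
  forall i, tnth e i ∈ x.

(* The collection {z | Q z} is (a set in V and) an element of C. *)
Definition class_in (C : V) (Q : V -> Prop) : Prop :=
  exists X, X ∈ C /\ forall z, z ∈ X <-> Q z.

(* The structure with sets the elements of M, classes the elements of C, and
   true membership, satisfies GB^-.  Class variables occur in the formulas of
   the schemes as predicates; equality of classes needs no atomic formula, by
   extensionality. *)
Record GBm (M C : V) : Prop := {
  gb_classes : forall X, X ∈ C -> X ⊆ M;
  gb_ext : forall x y, x ∈ M -> y ∈ M ->
    (forall z, z ∈ M -> (z ∈ x <-> z ∈ y)) -> x = y;
  gb_found : forall x, x ∈ M -> (exists y, y ∈ M /\ y ∈ x) ->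
    exists y, [/\ y ∈ M, y ∈ x & forall z, z ∈ M -> z ∈ x -> ~ z ∈ y];
  gb_pair : forall x y, x ∈ M -> y ∈ M ->
    exists z, z ∈ M /\ forall w, w ∈ M -> (w ∈ z <-> w = x \/ w = y);
  gb_union : forall x, x ∈ M ->
    exists u, u ∈ M /\
      forall w, w ∈ M -> (w ∈ u <-> exists y, [/\ y ∈ M, y ∈ x & w ∈ y]);
  gb_inf : exists x, [/\ x ∈ M,
    exists y, [/\ y ∈ M, y ∈ x & forall z, z ∈ M -> ~ z ∈ y] &
    forall y, y ∈ M -> y ∈ x ->
      exists z, [/\ z ∈ M, z ∈ x &
        forall w, w ∈ M -> (w ∈ z <-> w ∈ y \/ w = y)]];
  gb_sep : forall n m (f : form n m.+1) (A : n.-tuple V) (e : m.-tuple V) a,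
    all_in A C -> all_in e M -> a ∈ M ->
    exists b, b ∈ M /\ forall x, x ∈ M ->
      (x ∈ b <-> x ∈ a /\ sat M A f [tuple of x :: e]);
  gb_coll : forall n m (f : form n m.+2) (A : n.-tuple V) (e : m.-tuple V) a,
    all_in A C -> all_in e M -> a ∈ M ->
    (forall x, x ∈ M -> x ∈ a ->
      exists y, y ∈ M /\ sat M A f [tuple of x :: y :: e]) ->
    exists b, b ∈ M /\ forall x, x ∈ M -> x ∈ a ->
      exists y, [/\ y ∈ M, y ∈ b & sat M A f [tuple of x :: y :: e]];
  gb_class_ext : forall X Y, X ∈ C -> Y ∈ C ->
    (forall z, z ∈ M -> (z ∈ X <-> z ∈ Y)) -> X = Y;
  gb_class_found : forall X, X ∈ C -> (exists y, y ∈ M /\ y ∈ X) ->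
    exists y, [/\ y ∈ M, y ∈ X & forall z, z ∈ M -> z ∈ X -> ~ z ∈ y];
  gb_compr : forall n m (f : form n m.+1) (A : n.-tuple V) (e : m.-tuple V),
    all_in A C -> all_in e M ->
    exists X, X ∈ C /\ forall x, x ∈ M ->
      (x ∈ X <-> sat M A f [tuple of x :: e])
}.

Definition ctm_GBm (M C : V) : Prop :=
  [/\ GBm M C, transitive_set M, countable_set M & countable_set C].

Record forcing : Type := Forcing { fdom : V; fle : V; fone : V }.

Definition leq_in (le p q : V) : Prop := opair p q ∈ le.

Record preorder_with_top (P le one : V) : Prop := {
  po_rel : forall z, z ∈ le -> exists p q, [/\ p ∈ P, q ∈ P & z = opair p q];
  po_refl : forall p, p ∈ P -> leq_in le p p;
  po_trans : forall p q r, p ∈ P -> q ∈ P -> r ∈ P ->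
    leq_in le p q -> leq_in le q r -> leq_in le p r;
  po_one : one ∈ P;
  po_top : forall p, p ∈ P -> leq_in le p one
}.

Definition class_forcing (C : V) (P : forcing) : Prop :=
  [/\ fdom P ∈ C, fle P ∈ C & preorder_with_top (fdom P) (fle P) (fone P)].

Definition set_forcing (M C : V) (P : forcing) : Prop :=
  class_forcing C P /\ opair (fdom P) (fle P) ∈ M.

Definition induced_le (P : forcing) (Q : V) : V :=
  sep (fle P) (fun z => exists p q, [/\ p ∈ Q, q ∈ Q & z = opair p q]).

(* [Pa a] is P_a and [pi a p] is π_{a+1}(p); their values off Ord^M (resp. off
   Ord^M and the conditions) are irrelevant. The largest element of P_a is not
   required to be that of P. *)
Definition approachable_by_projections (M C : V) (P : forcing) : Prop :=
  exists Pa : V -> V,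
  [/\ forall a, in_Ord M a ->
        exists t, set_forcing M C (Forcing (Pa a) (induced_le P (Pa a)) t),
      class_in C (fun z => exists a,
        in_Ord M a /\ z = opair a (opair (Pa a) (induced_le P (Pa a)))),
      forall a b, in_Ord M a -> in_Ord M b -> a ∈ b -> Pa a ⊆ Pa b,
      forall l, in_Ord M l -> limit_set l ->
        forall p, p ∈ Pa l <-> exists a, a ∈ l /\ p ∈ Pa a &
      forall p, p ∈ fdom P <-> exists a, in_Ord M a /\ p ∈ Pa a] /\
  exists pi : V -> V -> V,
  [/\ forall a p, in_Ord M a -> p ∈ fdom P -> pi a p ∈ Pa (succ a),
      class_in C (fun z => exists a p,
        [/\ in_Ord M a, p ∈ fdom P & z = tup a [:: p; pi a p]]) &
      forall a, in_Ord M a ->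
      [/\ pi a (fone P) = fone P,
          forall p q, p ∈ fdom P -> q ∈ fdom P ->
            leq_in (fle P) p q -> leq_in (fle P) (pi a p) (pi a q),
          forall p q, p ∈ fdom P ->
            leq_in (induced_le P (Pa (succ a))) q (pi a p) ->
            exists r, leq_in (fle P) r p /\ leq_in (fle P) (pi a r) q,
          forall p q, p ∈ Pa a -> q ∈ fdom P ->
            leq_in (fle P) (pi a q) p -> leq_in (fle P) q p &
          forall p, p ∈ Pa a -> pi a p = p]].

Inductive is_name (P : V) (x : V) : Prop :=
| IsName of
    (forall z, z ∈ x -> exists t p, p ∈ P /\ z = opair t p) &
    (forall t p, opair t p ∈ x -> is_name P t).

Definition name_in (X : V) (P : forcing) (s : V) : Prop :=
  s ∈ X /\ is_name (fdom P) s.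

Definition name_dom (G s : V) : V :=
  sep (union (union s)) (fun t => exists p, p ∈ G /\ opair t p ∈ s).

Definition in_name_dom (G t s : V) : Prop := t ∈ name_dom G s.

Lemma in_name_domE (G t s : V) :
  t ∈ name_dom G s <-> exists p, p ∈ G /\ opair t p ∈ s.
Proof.
split; first by move=> /in_sep [].
move=> [p [pG ts]]; apply/in_sep; split; last by exists p.
apply/in_union; exists (upair t t); split; last by apply/in_upair; left.
apply/in_union; exists (opair t p); split=> //.
by apply/in_upair; left.
Qed.

Lemma in_name_dom_wf (G : V) : well_founded (in_name_dom G).
Proof.
suff H s : Acc (in_name_dom G) s /\ forall x, x ∈ s ->
    Acc (in_name_dom G) x /\ forall y, y ∈ x -> Acc (in_name_dom G) y.
  by move=> s; case: (H s).
elim/(well_founded_ind V_foundation): s => s IH; split; last first.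
  move=> x xs; have [Ax Hx] := IH x xs; split; first exact: Ax.
  by move=> y yx; have [Ay _] := Hx y yx; exact: Ay.
constructor=> t /in_name_domE [p [pG ts]]; have [_ H] := IH _ ts.
have [|_ H'] := H (upair t t); first by apply/in_upair; left.
by apply: H'; apply/in_upair; left.
Qed.

Definition val_step (G s : V) (rec : forall t, in_name_dom G t s -> V) : V :=
  mk (fun i : idx (name_dom G s) => rec (elt i) (mem_elt i)).

(* The evaluation s^G, characterised by [in_val]. *)
Definition val (G : V) : V -> V :=
  Fix (in_name_dom_wf G) (fun _ => V) (@val_step G).

Lemma in_val (G s z : V) :
  z ∈ val G s <-> exists t p, [/\ p ∈ G, opair t p ∈ s & z = val G t].
Proof.
rewrite /val Fix_eq; last first.
  by move=> x f g fg; congr mk; apply: funext => i; apply: fg.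
rewrite -/(val G) /val_step; split.
- move=> /in_mk [i ->].
  have /in_name_domE [p [pG ts]] : elt i ∈ name_dom G s by exact: mem_elt.
  by exists (elt i), p.
- move=> [t [p [pG ts ->]]]; apply/in_mk.
  have /memP [i ->] : t ∈ name_dom G s by apply/in_name_domE; exists p.
  by exists i.
Qed.

Definition is_filter (P : forcing) (G : V) : Prop :=
  [/\ G ⊆ fdom P,
      exists p, p ∈ G,
      forall p q, p ∈ G -> q ∈ fdom P -> leq_in (fle P) p q -> q ∈ G &
      forall p q, p ∈ G -> q ∈ G ->
        exists r, [/\ r ∈ G, leq_in (fle P) r p & leq_in (fle P) r q]].

Definition dense (P : forcing) (D : V) : Prop :=
  D ⊆ fdom P /\
  forall p, p ∈ fdom P -> exists q, q ∈ D /\ leq_in (fle P) q p.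

Definition generic (C : V) (P : forcing) (G : V) : Prop :=
  is_filter P G /\
  forall D, D ∈ C -> dense P D -> exists p, p ∈ D /\ p ∈ G.

Definition gen_ext (M : V) (P : forcing) (G : V) : V :=
  image (val G) (sep M (is_name (fdom P))).

Definition sat_ext (M : V) (P : forcing) (G : V) n (Gamma : n.-tuple V)
    m (f : form n m) (s : m.-tuple V) : Prop :=
  sat (gen_ext M P G) (map_tuple (val G) Gamma) f (map_tuple (val G) s).

Definition forces (M C : V) (P : forcing) n (Gamma : n.-tuple V) (p : V)
    m (f : form n m) (s : m.-tuple V) : Prop :=
  forall G, generic C P G -> p ∈ G -> sat_ext M P G Gamma f s.

Definition names_in (X : V) (P : forcing) m (s : m.-tuple V) : Prop :=
  forall i, name_in X P (tnth s i).

Definition definability_lemma (M C : V) (P : forcing) n m (f : form n m) : Prop :=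
  forall Gamma : n.-tuple V, names_in C P Gamma ->
  class_in C (fun z => exists p (s : m.-tuple V),
    [/\ p ∈ fdom P, names_in M P s, forces M C P Gamma p f s & z = tup p s]).

Definition truth_lemma (M C : V) (P : forcing) n m (f : form n m) : Prop :=
  forall (Gamma : n.-tuple V) (s : m.-tuple V) (G : V),
  names_in C P Gamma -> names_in M P s -> generic C P G ->
  sat_ext M P G Gamma f s ->
  exists p, p ∈ G /\ forces M C P Gamma p f s.

Definition forcing_theorem (M C : V) (P : forcing) n m (f : form n m) : Prop :=
  definability_lemma M C P f /\ truth_lemma M C P f.

Definition eq_formula : form 0 2 := fEq ord0 ord_max.

(* Main.v *)
(* The relation "p forces s = t" is the greatest fixpoint of its usual recursive
   clause, so it can be handled by coinduction without any recursion theorem.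
   If s and t are P_a-names, then conditions (2)-(5) on the projection pi_{a+1}
   make p ⊩_P s = t equivalent to pi_{a+1}(p) ⊩_{P_{a+1}} s = t.  Since P_{a+1}
   is a set, the latter holds iff some post-fixed point of the clause that is an
   element of M contains the triple: post-fixed points are closed under unions,
   and Collection glues those of the subnames together.  This makes the relation
   first-order definable over the model, and then the truth lemma follows for
   equality, and by induction for all formulas, by genericity arguments. *)
Require Import Defs.
From mathcomp Require Import all_boot.
From mathcomp Require Import boolp classical_sets cardinality.

Set Implicit Arguments.
Unset Strict Implicit.
Unset Printing Implicit Defensive.

Local Open Scope zf_scope.

(** * Definability over the model *)

(** The obstacle is that the clause for equality quantifies over a proper class of conditions, and
    first-order comprehension does not supply recursions of that kind. A witness of the greatest
    fixpoint is a single object, and over a set order it can be found in [M]. Of the conditions on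
    projections, (2) pushes the order down, (3) lifts extensions back to the class forcing, and (4)
    with (5) compares such conditions with those occurring in a name. Stage a+1 appears because its
    projection is required to be the identity on stage a, where the conditions of the two names lie.
    Taking a greatest fixpoint is harmless: names are well-founded, so induction on the first name
    shows that related names have equal values. *)

Lemma sat_ext_eq D n (A A' : n.-tuple V) m (f : form n m) (e e' : m.-tuple V) :
  tnth A =1 tnth A' -> tnth e =1 tnth e' -> sat D A f e <-> sat D A' f e'.
Proof. by move=> /eq_from_tnth -> /eq_from_tnth ->. Qed.

Definition lift_ren m m' (r : 'I_m -> 'I_m') (i : 'I_m.+1) : 'I_m'.+1 :=
  if unlift ord0 i is Some j then lift ord0 (r j) else ord0.

Fixpoint ren n n' (k : 'I_n -> 'I_n') m (f : form n m) :
    forall m', ('I_m -> 'I_m') -> form n' m' :=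
  match f in form _ m return forall m', ('I_m -> 'I_m') -> form n' m' with
  | fEq _ i j => fun _ r => fEq (r i) (r j)
  | fMem _ i j => fun _ r => fMem (r i) (r j)
  | fPred _ l i => fun _ r => fPred (k l) (r i)
  | fNot _ g => fun _ r => fNot (ren k g r)
  | fAnd _ g h => fun _ r => fAnd (ren k g r) (ren k h r)
  | fAll _ g => fun _ r => fAll (ren k g (lift_ren r))
  end.

Lemma sat_ren D n n' (k : 'I_n -> 'I_n') m (f : form n m) m'
    (r : 'I_m -> 'I_m') (A : n'.-tuple V) (e : m'.-tuple V) :
  sat D A (ren k f r) e <->
  sat D [tuple tnth A (k l) | l < n] f [tuple tnth e (r i) | i < m].
Proof.
elim: f m' r e => {m} /=.
- by move=> m i j m' r e; rewrite !tnth_mktuple.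
- by move=> m i j m' r e; rewrite !tnth_mktuple.
- by move=> m l i m' r e; rewrite !tnth_mktuple.
- by move=> m f IH m' r e; rewrite IH.
- by move=> m f IHf g IHg m' r e; rewrite IHf IHg.
- move=> m f IH m' r e; split=> H x xD; move: (H x xD); rewrite IH;
    apply: (iffLR (sat_ext_eq _ _ _ _)) => // i; rewrite !tnth_mktuple /lift_ren;
    case: unliftP => [j ->|->]; rewrite ?tnthS ?tnth0 ?tnth_mktuple //=.
Qed.

(** Infinite environments spare the bookkeeping of arities: a formula sees an initial segment only,
    and renaming variables is precomposition. *)
Definition env := nat -> V.
Definition scons (x : V) (r : env) : env := fun i => if i is j.+1 then r j else x.

Section Definability.
Variables M C : V.

Definition in_env (r : env) : Prop := forall i, r i ∈ M.

Lemma in_env_scons x r : x ∈ M -> in_env r -> in_env (scons x r).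
Proof. by move=> xM rM [|i] //=. Qed.

(* Definable without set parameters over (M, ∈) from finitely many classes; a
   set parameter enters as the class of its elements. *)
Definition dfn (Q : env -> Prop) : Prop :=
  exists n (A : n.-tuple V) m (f : form n m), all_in A C /\
    forall r, in_env r -> (Q r <-> sat M A f [tuple r i | i < m]).

Lemma dfn_ext (Q Q' : env -> Prop) :
  (forall r, in_env r -> (Q r <-> Q' r)) -> dfn Q -> dfn Q'.
Proof.
move=> E [n [A [m [f [AC H]]]]]; exists n, A, m, f; split=> // r rM.
by rewrite -H // E.
Qed.

Lemma dfn_ren (s : nat -> nat) (Q : env -> Prop) :
  dfn Q -> dfn (fun r => Q (fun i => r (s i))).
Proof.
move=> [n [A [m [f [AC H]]]]].
have lts (i : 'I_m) : s i < (\max_(j < m) s j).+1.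
  by rewrite ltnS (leq_bigmax (F := fun j : 'I_m => s j)).
exists n, A, _, (ren id f (fun i => Ordinal (lts i))); split=> // r rM.
rewrite H; last by move=> i; apply: rM.
by rewrite sat_ren; apply: sat_ext_eq => i; rewrite !tnth_mktuple.
Qed.

Lemma dfn_not (Q : env -> Prop) : dfn Q -> dfn (fun r => ~ Q r).
Proof.
move=> [n [A [m [f [AC H]]]]]; exists n, A, m, (fNot f); split=> // r rM /=.
by rewrite H.
Qed.

Lemma dfn_and (Q Q' : env -> Prop) :
  dfn Q -> dfn Q' -> dfn (fun r => Q r /\ Q' r).
Proof.
move=> [n [A [m [f [AC H]]]]] [n' [A' [m' [f' [AC' H']]]]].
exists _, [tuple of A ++ A'], _,
  (fAnd (ren (@lshift n n') f (widen_ord (leq_maxl m m')))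
        (ren (@rshift n n') f' (widen_ord (leq_maxr m m')))).
split; first by move=> i; case: (split_ordP i) => j ->;
  rewrite ?tnth_lshift ?tnth_rshift.
move=> r rM /=; rewrite H // H' // !sat_ren.
have E : forall D E F G : Prop, (D <-> F) -> (E <-> G) -> (D /\ E <-> F /\ G).
  by move=> ? ? ? ? -> ->.
by apply: E; apply: sat_ext_eq => i;
  rewrite !tnth_mktuple ?tnth_lshift ?tnth_rshift.
Qed.

Lemma dfn_all (Q : env -> V -> Prop) :
  dfn (fun r => Q (fun i => r i.+1) (r 0)) ->
  dfn (fun r => forall x, x ∈ M -> Q r x).
Proof.
move=> [n [A [m [f [AC H]]]]].
exists n, A, m, (fAll (ren id f (widen_ord (leqnSn m)))); split=> // r rM /=.
have E x : x ∈ M -> (Q r x <->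
    sat M A (ren id f (widen_ord (leqnSn m))) [tuple of x :: [tuple r i | i < m]]).
  move=> xM; rewrite (H (scons x r)); last exact: in_env_scons.
  rewrite sat_ren; apply: sat_ext_eq => i; rewrite !tnth_mktuple //.
  case: (unliftP ord0 (widen_ord (leqnSn m) i)) => [j E|E]; rewrite E.
    by rewrite tnthS tnth_mktuple; have -> : (i : nat) = j.+1 by
      have := congr1 val E; rewrite /= => ->.
  by rewrite tnth0; have -> : (i : nat) = 0 by have := congr1 val E.
by split=> K x xM; apply/(E x xM)/K.
Qed.

Lemma dfn_True : dfn (fun=> True).
Proof.
exists 0, [tuple], 1, (fEq ord0 ord0); split=> [[]|r rM] //=.
Qed.

(** Excluded middle: a proposition that ignores the environment amounts to truth or to falsity,
    whatever it talks about. *)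
Lemma dfn_Prop (p : Prop) : dfn (fun=> p).
Proof.
have [Hp|Hp] := pselect p; first by apply: dfn_ext dfn_True.
by apply: dfn_ext (dfn_not dfn_True) => r _; split.
Qed.

Lemma dfn_imp (Q Q' : env -> Prop) :
  dfn Q -> dfn Q' -> dfn (fun r => Q r -> Q' r).
Proof.
move=> H H'; apply: dfn_ext (dfn_not (dfn_and H (dfn_not H'))) => r _.
split=> [K q|K [q nq]]; last exact: nq (K q).
by apply: contrapT => nq; apply: K.
Qed.

Lemma dfn_or (Q Q' : env -> Prop) :
  dfn Q -> dfn Q' -> dfn (fun r => Q r \/ Q' r).
Proof.
move=> H H'; apply: dfn_ext (dfn_imp (dfn_not H) H') => r _.
split=> [K|[q|q] nq] //; have [q|nq] := pselect (Q r); first by left.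
by right; apply: K.
Qed.

Lemma dfn_iff (Q Q' : env -> Prop) :
  dfn Q -> dfn Q' -> dfn (fun r => Q r <-> Q' r).
Proof. by move=> H H'; apply: dfn_and; apply: dfn_imp. Qed.

Lemma dfn_ex (Q : env -> V -> Prop) :
  dfn (fun r => Q (fun i => r i.+1) (r 0)) ->
  dfn (fun r => exists x, x ∈ M /\ Q r x).
Proof.
move=> H; apply: dfn_ext (dfn_not (dfn_all (Q := fun r x => ~ Q r x) (dfn_not H))).
move=> r _; split=> [K|[x [xM Qx]] K]; last exact: K Qx.
apply: contrapT => nK; apply: K => x xM Qx; apply: nK; by exists x.
Qed.

(** Values in [M] are demanded so that a term can be eliminated in favour of a quantifier over [M],
    as in [dfn_subst]. *)
Definition dterm (t : env -> V) : Prop :=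
  (forall r, in_env r -> t r ∈ M) /\
  dfn (fun r => r 0 = t (fun i => r i.+1)).

Lemma dfn_vareq i j : dfn (fun r => r i = r j).
Proof.
apply: (@dfn_ren (fun k => if k is 0 then i else j) (fun r => r 0 = r 1)).
exists 0, [tuple], 2, (fEq ord0 (lift ord0 ord0)); split=> [[]|r rM] //=.
by rewrite !tnth_mktuple.
Qed.

Lemma dfn_varmem i j : dfn (fun r => r i ∈ r j).
Proof.
apply: (@dfn_ren (fun k => if k is 0 then i else j) (fun r => r 0 ∈ r 1)).
exists 0, [tuple], 2, (fMem ord0 (lift ord0 ord0)); split=> [[]|r rM] //=.
by rewrite !tnth_mktuple.
Qed.

Lemma dfn_varcls X i : X ∈ C -> dfn (fun r => r i ∈ X).
Proof.
move=> XC; apply: (@dfn_ren (fun k => i) (fun r => r 0 ∈ X)).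
exists 1, [tuple X], 1, (fPred ord0 ord0); split=> [j|r rM] /=.
  by rewrite (ord1 j).
by rewrite !tnth_mktuple tnth0.
Qed.

Lemma dterm_var i : dterm (fun r => r i).
Proof. by split=> [r /(_ i)|] //; apply: dfn_vareq. Qed.

Lemma dterm_ren s t : dterm t -> dterm (fun r => t (fun i => r (s i))).
Proof.
move=> [tM td]; split; first by move=> r rM; apply: tM => i; apply: rM.
exact: (@dfn_ren (fun k => if k is j.+1 then (s j).+1 else 0) _ td).
Qed.

Lemma dfn_subst (Q : env -> V -> Prop) (t : env -> V) : dterm t ->
  dfn (fun r => Q (fun i => r i.+1) (r 0)) -> dfn (fun r => Q r (t r)).
Proof.
move=> [tM td] H.
apply: dfn_ext (dfn_ex (Q := fun r x => x = t r /\ Q r x) (dfn_and td H)).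
move=> r rM; split=> [[x [xM [->]]] //|Qt].
by exists (t r); split; [exact: tM|].
Qed.

Lemma dfn_mem s t : dterm s -> dterm t -> dfn (fun r => s r ∈ t r).
Proof.
move=> sd td; apply: (dfn_subst (Q := fun r x => x ∈ t r) sd).
apply: (dfn_subst (Q := fun r x => r 0 ∈ x)); last exact: dfn_varmem.
exact: dterm_ren td.
Qed.

Lemma dfn_eq s t : dterm s -> dterm t -> dfn (fun r => s r = t r).
Proof.
move=> sd td; apply: (dfn_subst (Q := fun r x => x = t r) sd).
apply: (dfn_subst (Q := fun r x => r 0 = x)); last exact: dfn_vareq.
exact: dterm_ren td.
Qed.

Lemma dfn_cls X t : X ∈ C -> dterm t -> dfn (fun r => t r ∈ X).
Proof.
move=> XC td; apply: (dfn_subst (Q := fun r x => x ∈ X) td).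
exact: dfn_varcls.
Qed.

(** Tuples of names of arbitrary length call for a block of quantifiers whose length is a parameter.
    Only the first [k] values of [s] matter, so the infinite [s] amounts to [k] quantifiers over
    [M]. *)
Lemma dfn_exn k (Q : env -> Prop) : dfn Q ->
  dfn (fun r => exists s, in_env s /\ Q (fun i => if i < k then s i else r (i - k))).
Proof.
elim: k Q => [|k IH] Q H.
  apply: dfn_ext H => r rM.
  have E s : (fun i => if i < 0 then s i else r (i - 0)) = r.
    by apply: funext => i; rewrite /= subn0.
  by split=> [Qr|[s [_]]]; [exists r|]; rewrite E.
have E x s (r : env) : (fun i => if i < k.+1 then scons x s i else r (i - k.+1)) =
    scons x (fun i => if i < k then s i else r (i - k)).
  by apply: funext => -[|i].
have H' : dfn (fun r => exists x, x ∈ M /\ Q (scons x r)).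
  apply: dfn_ex; apply: dfn_ext H => r _.
  by rewrite (_ : scons _ _ = r) //; apply: funext => -[|i].
apply: dfn_ext (IH _ H') => r rM; split.
  move=> [s [sM [x [xM Qx]]]]; exists (scons x s).
  by rewrite E; split=> //; apply: in_env_scons.
move=> [s [sM Qs]]; exists (fun i => s i.+1); split; first by move=> i; apply: sM.
exists (s 0); split; first exact: sM.
by rewrite -E (_ : scons _ _ = s) //; apply: funext => -[|i].
Qed.

End Definability.

(** * Closure properties of the model *)

Lemma in_opair_union x y : x ∈ union (opair x y) /\ y ∈ union (opair x y).
Proof.
split; apply/in_union.
  by exists (upair x x); split; apply/in_upair; left.
by exists (upair x y); split; apply/in_upair; right.
Qed.

Definition adjoin (x y : V) : V := union (upair x (upair y y)).

Lemma in_adjoin x y z : z ∈ adjoin x y <-> z ∈ x \/ z = y.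
Proof.
split=> [/in_union [w [/in_upair [->|->] zw]]|[zx|->]]; first by left.
- by right; case/in_upair: zw.
- by apply/in_union; exists x; split=> //; apply/in_upair; left.
- by apply/in_union; exists (upair y y); split; apply/in_upair; [right|left].
Qed.

Lemma ordinal_trans_of_trans x : transitive_set x ->
  (forall y, y ∈ x -> transitive_set y) ->
  forall y z, y ∈ x -> z ∈ x -> [\/ y ∈ z, y = z | z ∈ y].
Proof.
move=> tx ty; elim/(well_founded_ind V_foundation) => y IHy.
elim/(well_founded_ind V_foundation) => z IHz yx zx.
have [zy|nzy] := pselect (z ∈ y); first by constructor 3.
have [yz|nyz] := pselect (y ∈ z); first by constructor 1.
constructor 2; apply: V_extensionality => w; split=> [wy|wz].
  case: (IHy w wy z (tx _ yx _ wy) zx) => // [E|zw]; first by case: nzy; rewrite -E.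
  by case: nzy; apply: (ty _ yx _ wy).
case: (IHz w wz yx (tx _ zx _ wz)) => // [yw|E]; last by case: nyz; rewrite E.
by case: nyz; apply: (ty _ zx _ wz).
Qed.

(** Membership is well-founded in the ambient universe, so irreflexivity, comparability and minimal
    elements follow from transitivity. What remains is a bounded formula that is easy to handle
    under unions. *)
Lemma ordinal_setE x : ordinal_set x <->
  transitive_set x /\ forall y, y ∈ x -> transitive_set y.
Proof.
split.
  move=> [tx _ tr _ _]; split=> // y yx z zy w wz.
  have zx := tx _ yx _ zy; exact: (tr w z y) (tx _ zx _ wz) zx yx wz zy.
move=> [tx ty]; split=> //.
- move=> y _; elim/(well_founded_ind V_foundation): y => y IH h; exact: (IH y h h).
- by move=> y z w _ zx wx yz zw; apply: (ty _ wx) zw _ yz.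
- exact: ordinal_trans_of_trans.
- move=> u _ [y]; elim/(well_founded_ind V_foundation): y => y IH yu.
  have [[z [zu zy]]|n] := pselect (exists z, z ∈ u /\ z ∈ y); first exact: IH zu.
  by exists y; split=> // z zu zy; apply: n; exists z.
Qed.

Lemma ordinal_union b : (forall a, a ∈ b -> ordinal_set a) -> ordinal_set (union b).
Proof.
move=> ob; apply/ordinal_setE; split.
  move=> y /in_union [a [ab ya]] z zy; apply/in_union; exists a; split=> //.
  by have /ordinal_setE [ta _] := ob _ ab; apply: ta zy.
by move=> y /in_union [a [/ob /ordinal_setE [_ ta] ya]]; apply: ta.
Qed.

Lemma ordinal_succ a : ordinal_set a -> ordinal_set (succ a).
Proof.
move=> /ordinal_setE [ta tta]; apply/ordinal_setE; split.
  move=> y /in_succ ya z zy; apply/in_succ; left.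
  by case: ya zy => [ya|->]; [apply: ta|].
by move=> y /in_succ [/tta|->].
Qed.

Section Model.
Variables M C : V.
Hypothesis hM : ctm_GBm M C.

Local Notation dfn := (dfn M C).
Local Notation dterm := (dterm M C).

Lemma mem_M x y : x ∈ y -> y ∈ M -> x ∈ M.
Proof. by case: hM => _ tM _ _ xy yM; apply: tM yM _ xy. Qed.

Lemma class_M X x : X ∈ C -> x ∈ X -> x ∈ M.
Proof. by case: hM => g _ _ _ XC; apply: gb_classes g _ XC _. Qed.

Lemma M_upair x y : x ∈ M -> y ∈ M -> upair x y ∈ M.
Proof.
case: hM => g _ _ _ xM yM; have [z [zM E]] := gb_pair g xM yM.
suff -> : upair x y = z by [].
apply: V_extensionality => w; rewrite in_upair; split=> [H|wz]; last first.
  by apply/E => //; apply: mem_M wz zM.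
by apply/E => //; case: H => ->.
Qed.

Lemma M_union x : x ∈ M -> union x ∈ M.
Proof.
case: hM => g _ _ _ xM; have [z [zM E]] := gb_union g xM.
suff -> : union x = z by [].
apply: V_extensionality => w; rewrite in_union; split=> [[y [yx wy]]|wz].
  have yM := mem_M yx xM; apply/E; first exact: mem_M wy yM.
  by exists y.
by have /(E _ (mem_M wz zM)) [y [_ yx wy]] := wz; exists y.
Qed.

Lemma M_opair x y : x ∈ M -> y ∈ M -> opair x y ∈ M.
Proof. by move=> xM yM; apply: M_upair; apply: M_upair. Qed.

Lemma M_opairP x y : opair x y ∈ M -> x ∈ M /\ y ∈ M.
Proof.
by move=> /M_union uM; have [xu yu] := in_opair_union x y; split; apply: mem_M uM.
Qed.

Lemma opair_in_M x y z : opair x y ∈ z -> z ∈ M -> x ∈ M /\ y ∈ M.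
Proof. by move=> h /(mem_M h) /M_opairP. Qed.

Lemma M_adjoin x y : x ∈ M -> y ∈ M -> adjoin x y ∈ M.
Proof. by move=> xM yM; apply: M_union; apply: M_upair => //; apply: M_upair. Qed.

Lemma M_succ x : x ∈ M -> succ x ∈ M.
Proof. by move=> xM; apply: M_adjoin. Qed.

Lemma M_inhabited : exists x, x ∈ M.
Proof. by case: hM => g _ _ _; have [x [xM _ _]] := gb_inf g; exists x. Qed.

(** Brings a definable predicate into the shape of the axiom schemes: two distinguished variables,
    and a parameter tuple filled with one arbitrary element of [M]. *)
Lemma dfn_form2 (Q : env -> Prop) : dfn Q -> exists n (A : n.-tuple V) m (f : form n m.+2)
  (e : m.-tuple V) r0, [/\ all_in A C, all_in e M, in_env M r0 &
    forall x y, x ∈ M -> y ∈ M ->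
      (sat M A f [tuple of x :: y :: e] <-> Q (scons x (scons y r0)))].
Proof.
move=> [n [A [m [f [AC H]]]]]; have [x0 x0M] := M_inhabited.
have lem : m <= m.+2 by rewrite -addn2 leq_addr.
exists n, A, m, (ren id f (widen_ord lem)), [tuple of nseq m x0], (fun=> x0).
split=> // [i|x y xM yM].
  by rewrite (tnth_nth x0) /= nth_nseq if_same.
rewrite H; last by do 2!apply: in_env_scons => //.
rewrite sat_ren; apply: sat_ext_eq => -[[|[|i]] lti]; rewrite !tnth_mktuple //.
by rewrite !(tnth_nth x0) /= nth_nseq if_same.
Qed.

Lemma compr (Q : V -> Prop) : dfn (fun r => Q (r 0)) ->
  (forall x, Q x -> x ∈ M) -> class_in C Q.
Proof.
move=> /dfn_form2 [n [A [m [f [e [r0 [AC eM r0M H]]]]]]] QM; case: hM => g _ _ _.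
have xM := r0M 0.
have eM' : all_in [tuple of r0 0 :: e] M.
  by move=> i; case: (unliftP ord0 i) => [j ->|->]; rewrite ?tnthS ?tnth0.
have [X [XC E]] := gb_compr g f AC eM'.
exists X; split=> // z; split=> [zX|Qz].
  have zM := class_M XC zX; have /(E _ zM) := zX.
  by move/(iffLR (sat_ext_eq _ _ (fun=> erefl) (fun=> erefl))) => /(H _ _ zM xM).
by have zM := QM _ Qz; apply/(E _ zM)/(H _ _ zM xM).
Qed.

Lemma M_sep (Q : V -> Prop) a : a ∈ M -> dfn (fun r => Q (r 0)) -> sep a Q ∈ M.
Proof.
move=> aM /dfn_form2 [n [A [m [f [e [r0 [AC eM r0M H]]]]]]]; case: hM => g _ _ _.
have xM := r0M 0.
have eM' : all_in [tuple of r0 0 :: e] M.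
  by move=> i; case: (unliftP ord0 i) => [j ->|->]; rewrite ?tnthS ?tnth0.
have [b [bM E]] := gb_sep g f AC eM' aM.
suff -> : sep a Q = b by [].
apply: V_extensionality => z; rewrite in_sep; split=> [[za Qz]|zb].
  by have zM := mem_M za aM; apply/(E _ zM); split=> //; apply/(H _ _ zM xM).
have zM := mem_M zb bM; have /(E _ zM) [za S] := zb.
by split=> //; apply/(H _ _ zM xM).
Qed.

Lemma M_coll (R : V -> V -> Prop) a : a ∈ M -> dfn (fun r => R (r 0) (r 1)) ->
  (forall x, x ∈ a -> exists y, y ∈ M /\ R x y) ->
  exists b, b ∈ M /\ forall x, x ∈ a -> exists y, y ∈ b /\ R x y.
Proof.
move=> aM /dfn_form2 [n [A [m [f [e [r0 [AC eM r0M H]]]]]]] HR; case: hM => g _ _ _.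
have [x xM xa|b [bM Hb]] := gb_coll g (f := f) AC eM aM.
  have [y [yM Rxy]] := HR x xa; exists y; split=> //.
  exact/(H _ _ xM yM).
exists b; split=> // x xa; have xM := mem_M xa aM.
have [y [yM yb S]] := Hb x xM xa; exists y; split=> //.
exact/(H _ _ xM yM).
Qed.

(** Collection may return many candidates for each [x], and also sets without [K]. Separating by [K]
    and taking the union merges them into one set, since [K] survives unions and [R] survives
    enlargement; no choice inside the model is involved. *)
Lemma directed_coll (K : V -> Prop) (R : V -> V -> Prop) a : a ∈ M ->
  dfn (fun r => K (r 0)) -> dfn (fun r => R (r 0) (r 1)) ->
  (forall b, (forall F, F ∈ b -> K F) -> K (union b)) ->
  (forall x F F', F ⊆ F' -> R x F -> R x F') ->
  (forall x, x ∈ a -> exists F, [/\ F ∈ M, K F & R x F]) ->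
  exists F, [/\ F ∈ M, K F & forall x, x ∈ a -> R x F].
Proof.
move=> aM Kd Rd KU Rmono HR.
have [||b [bM Hb]] := M_coll (R := fun x F => K F /\ R x F) aM.
- apply: dfn_and Rd; exact: (@dfn_ren _ _ (fun=> 1) _ Kd).
- by move=> x xa; have [F [FM KF Rx]] := HR x xa; exists F.
exists (union (sep b K)); split.
- by apply: M_union => //; apply: M_sep.
- by apply: KU => F /in_sep [].
- move=> x xa; have [F [Fb [KF Rx]]] := Hb x xa.
  apply: Rmono Rx => z zF; apply/in_union; exists F; split=> //.
  exact/in_sep.
Qed.

Lemma dterm_const c : c ∈ M -> dterm (fun=> c).
Proof.
move=> cM; split=> //; case: hM => g _ _ _.
have eM : all_in [tuple c] M by move=> i; rewrite (ord1 i).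
have AC : all_in ([tuple] : 0.-tuple V) C by case.
(* The class [X] is the singleton of [c]. *)
have [X [XC E]] := gb_compr g (fEq ord0 (lift ord0 ord0)) AC eM.
apply: dfn_ext (dfn_varcls M 0 XC) => r rM.
by rewrite E //= tnthS.
Qed.

Lemma dfn_sub1 (Q : V -> Prop) s : dfn (fun r => Q (r 0)) -> dterm s ->
  dfn (fun r => Q (s r)).
Proof. by move=> H sd; apply: (dfn_subst (Q := fun r => Q) sd). Qed.

Lemma dfn_sub2 (Q : V -> V -> Prop) s t : dfn (fun r => Q (r 0) (r 1)) ->
  dterm s -> dterm t -> dfn (fun r => Q (s r) (t r)).
Proof.
move=> H sd td; apply: (dfn_subst (Q := fun r x => Q x (t r)) sd).
apply: (dfn_subst (Q := fun r x => Q (r 0) x)); first exact: dterm_ren td.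
exact: (@dfn_ren _ _ (fun i => if i is 0 then 1 else 0) _ H).
Qed.

Lemma dfn_sub3 (Q : V -> V -> V -> Prop) s t u :
  dfn (fun r => Q (r 0) (r 1) (r 2)) ->
  dterm s -> dterm t -> dterm u -> dfn (fun r => Q (s r) (t r) (u r)).
Proof.
move=> H sd td ud; apply: (dfn_subst (Q := fun r x => Q x (t r) (u r)) sd).
apply: (dfn_subst (Q := fun r x => Q (r 0) x (u (fun i => r i.+1)))).
  exact: dterm_ren td.
apply: (dfn_subst (Q := fun r x => Q (r 1) (r 0) x)).
  by apply: dterm_ren; apply: dterm_ren ud.
exact: (@dfn_ren _ _ (fun i => if i is 0 then 2 else if i is 1 then 1 else 0) _ H).
Qed.

(** Transitivity of [M] makes a quantifier bounded by a set of [M] agree with the one relativised to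
    [M]. *)
Lemma dfn_allin (Q : env -> V -> Prop) t : dterm t ->
  dfn (fun r => Q (fun i => r i.+1) (r 0)) ->
  dfn (fun r => forall x, x ∈ t r -> Q r x).
Proof.
move=> td H.
apply: (dfn_ext _ (dfn_all (Q := fun r x => x ∈ t r -> Q r x) _)); last first.
  apply: dfn_imp H; apply: dfn_mem; first exact: dterm_var.
  exact: dterm_ren td.
move=> r rM; split=> K x; last by move=> _; apply: K.
by move=> xt; apply: (K x (mem_M xt (td.1 r rM))).
Qed.

Lemma dfn_exin (Q : env -> V -> Prop) t : dterm t ->
  dfn (fun r => Q (fun i => r i.+1) (r 0)) ->
  dfn (fun r => exists x, x ∈ t r /\ Q r x).
Proof.
move=> td H.
apply: (dfn_ext _ (dfn_ex (Q := fun r x => x ∈ t r /\ Q r x) _)); last first.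
  apply: dfn_and H; apply: dfn_mem; first exact: dterm_var.
  exact: dterm_ren td.
move=> r rM; split=> [[x [_ K]]|[x [xt K]]]; exists x => //.
by split=> //; apply: mem_M xt (td.1 r rM).
Qed.

Lemma M_extensionality x y : x ∈ M -> y ∈ M ->
  x = y <-> forall z, z ∈ M -> (z ∈ x <-> z ∈ y).
Proof.
move=> xM yM; split=> [-> //|H]; apply: V_extensionality => z.
by split=> h; apply/H => //; apply: mem_M h _.
Qed.

Lemma dterm_upair s t : dterm s -> dterm t -> dterm (fun r => upair (s r) (t r)).
Proof.
move=> sd td; split.
  by move=> r rM; apply: M_upair; [apply: sd.1|apply: td.1].
apply: (dfn_sub3 (Q := fun x y z => x = upair y z)); last first.
- exact: dterm_ren td.
- exact: dterm_ren sd.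
- exact: dterm_var.
apply: (dfn_ext (Q := fun r => forall z, z ∈ M -> (z ∈ r 0 <-> z = r 1 \/ z = r 2))).
  move=> r rM; rewrite M_extensionality //; last exact: M_upair.
  by split=> H z zM; rewrite H // in_upair.
apply: dfn_all; apply: dfn_iff; first exact: dfn_varmem.
by apply: dfn_or; apply: dfn_vareq.
Qed.

Lemma dterm_union t : dterm t -> dterm (fun r => union (t r)).
Proof.
move=> td; split.
  by move=> r rM; apply: M_union; apply: td.1.
apply: (dfn_sub2 (Q := fun x y => x = union y)); last first.
- exact: dterm_ren td.
- exact: dterm_var.
apply: (dfn_ext (Q := fun r => forall z, z ∈ M ->
    (z ∈ r 0 <-> exists y, y ∈ r 1 /\ z ∈ y))).
  move=> r rM; rewrite M_extensionality //; last exact: M_union.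
  by split=> H z zM; rewrite H // in_union.
apply: dfn_all; apply: dfn_iff; first exact: dfn_varmem.
by apply: dfn_exin; [exact: dterm_var|exact: dfn_varmem].
Qed.

Lemma dterm_opair s t : dterm s -> dterm t -> dterm (fun r => opair (s r) (t r)).
Proof. by move=> sd td; apply: dterm_upair; apply: dterm_upair. Qed.

Lemma dterm_succ t : dterm t -> dterm (fun r => succ (t r)).
Proof.
by move=> td; apply: dterm_union; apply: dterm_upair => //; apply: dterm_upair.
Qed.

Lemma dfn_leq l p q : dterm l -> dterm p -> dterm q ->
  dfn (fun r => leq_in (l r) (p r) (q r)).
Proof. by move=> ld pd qd; apply: dfn_mem => //; apply: dterm_opair. Qed.

Lemma dfn_leq_class l p q : l ∈ C -> dterm p -> dterm q ->
  dfn (fun r => leq_in l (p r) (q r)).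
Proof. by move=> lC pd qd; apply: dfn_cls => //; apply: dterm_opair. Qed.

End Model.

Ltac dfn_tac_with tac :=
  repeat (cbv beta;
  first [ assumption | tac | apply: dterm_var | apply: dterm_opair
        | apply: dterm_succ
        | apply: dterm_const; [eassumption|assumption]
        | apply: dfn_and | apply: dfn_or | apply: dfn_iff
        | apply: dfn_not
        | apply: dfn_all | apply: dfn_ex
        | apply: dfn_allin; [eassumption| |] | apply: dfn_exin; [eassumption| |]
        | apply: dfn_imp
        | apply: dfn_eq
        | eapply dfn_cls; [eassumption|] | apply: dfn_mem
        | eapply dfn_leq_class; [eassumption|eassumption| |] | apply: dfn_leq
        | apply: dfn_Prop ]).

Ltac dfn_tac := dfn_tac_with fail.

(** * Forcing equality *)

Lemma in_opair_union2 x y z : opair x y ∈ z ->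
  x ∈ union (union z) /\ y ∈ union (union z).
Proof.
have [/in_union [u [ux xu]] /in_union [v [vy yv]]] := in_opair_union x y.
by move=> h; split; apply/in_union; [exists u|exists v]; split=> //;
  apply/in_union; exists (opair x y).
Qed.

Lemma po_in P le one p q : preorder_with_top P le one -> leq_in le p q ->
  p ∈ P /\ q ∈ P.
Proof. by move=> h /(po_rel h) [p' [q' [p'P q'P /opair_inj [-> ->]]]]. Qed.

Lemma po_leq_trans P le one p q r : preorder_with_top P le one ->
  leq_in le p q -> leq_in le q r -> leq_in le p r.
Proof.
move=> h pq qr; have [pP qP] := po_in h pq; have [_ rP] := po_in h qr.
exact: (po_trans h) pq qr.
Qed.

Definition triple_in (F p s t : V) : Prop := opair p (opair s t) ∈ F.

(* Lets both inclusions of [eq_step F p s t] consult the same triples, with the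
   subname of [s] first, so that induction on [s] alone suffices. *)
Definition flip3 (F : V -> V -> V -> Prop) (p s t : V) : Prop := F p t s.

Section ForcingEquality.
Variables M le : V.
Implicit Types F G : V -> V -> V -> Prop.

(** Quantifiers are relativised to [M] one at a time, the shape that [dfn_ex] expects. *)
Definition mem_at F (q s t : V) : Prop :=
  exists u, u ∈ M /\ exists r, r ∈ M /\
    (opair u r ∈ t /\ (leq_in le q r /\ F q s u)).

(** A single extension is enough: wherever this is used, [q] ranges over all conditions below given
    ones, which turns it into density. *)
Definition mem_step F (q s t : V) : Prop :=
  exists q', q' ∈ M /\ (leq_in le q' q /\ mem_at F q' s t).

Definition sub_step F (p s t : V) : Prop :=
  forall u, u ∈ M -> forall r, r ∈ M -> opair u r ∈ s ->
  forall q, q ∈ M -> leq_in le q p -> leq_in le q r -> mem_step F q u t.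

Definition eq_step F (p s t : V) : Prop :=
  sub_step F p s t /\ sub_step (flip3 F) p t s.

Definition post_fixed F : Prop := forall p s t, F p s t -> eq_step F p s t.

(** Here [F] ranges over all predicates of the ambient universe, so definability over the model
    cannot be read off. *)
Definition force_eq (p s t : V) : Prop := exists F, post_fixed F /\ F p s t.

Lemma mem_step_mono F G q s t :
  (forall x u, F x s u -> G x s u) -> mem_step F q s t -> mem_step G q s t.
Proof.
move=> FG [x [xM [xq [u [uM [r [rM [urt [xr H]]]]]]]]].
exists x; split=> //; split=> //; exists u; split=> //; exists r.
by do !split=> //; apply: FG.
Qed.

Lemma sub_step_mono F G p s t :
  (forall u r x v, opair u r ∈ s -> F x u v -> G x u v) ->
  sub_step F p s t -> sub_step G p s t.
Proof.
move=> FG H u uM r rM urs q qM qp qr.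
by apply: mem_step_mono (H u uM r rM urs q qM qp qr) => x v; apply: FG urs.
Qed.

Lemma eq_step_mono F G p s t :
  (forall x u v, F x u v -> G x u v) -> eq_step F p s t -> eq_step G p s t.
Proof.
by move=> FG [H H']; split; [apply: sub_step_mono H|apply: sub_step_mono H'] =>
  u r x v _; apply: FG.
Qed.

(** Knaster-Tarski: by monotonicity, the step applied to the greatest post-fixed relation is again
    post-fixed. *)
Lemma force_eqE p s t : force_eq p s t <-> eq_step force_eq p s t.
Proof.
have D p' s' t' : force_eq p' s' t' -> eq_step force_eq p' s' t'.
  move=> [F [pF Fp]]; apply: eq_step_mono (pF _ _ _ Fp) => x u v Fx.
  by exists F.
split; first exact: D.
move=> H; exists (eq_step force_eq); split=> // p' s' t'.
by apply: eq_step_mono => x u v; apply: D.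
Qed.

Lemma force_eq_weaken p q s t :
  (forall x y z, leq_in le x y -> leq_in le y z -> leq_in le x z) ->
  leq_in le q p -> force_eq p s t -> force_eq q s t.
Proof.
move=> tr qp /force_eqE [H H']; apply/force_eqE; split=> u uM r rM urs x xM xq xr.
  by apply: (H u uM r rM urs) xr => //; apply: tr qp.
by apply: (H' u uM r rM urs) xr => //; apply: tr qp.
Qed.

End ForcingEquality.

(** * Transfer of forced equality along a projection *)

Section Projection.
Variables (M le leQ P Q : V) (pr : V -> V).
Hypothesis leM : forall p q, leq_in le p q -> p ∈ M /\ p ∈ P.
Hypothesis leQM : forall p q, leq_in leQ p q -> p ∈ M.
Hypothesis leQ_trans : forall x y z, leq_in leQ x y -> leq_in leQ y z -> leq_in leQ x z.
Hypothesis pr_mono : forall p q, leq_in le p q -> leq_in leQ (pr p) (pr q).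
Hypothesis pr_lift : forall p q, p ∈ P -> leq_in leQ q (pr p) ->
  exists r, leq_in le r p /\ leq_in leQ (pr r) q.
Hypothesis pr_below : forall p q, p ∈ Q -> q ∈ P -> leq_in leQ (pr q) p -> leq_in le q p.
Hypothesis pr_id : forall p, p ∈ Q -> pr p = p.

Definition names_rel (F : V -> V -> V -> Prop) (p s t : V) : Prop :=
  [/\ F p s t, is_name Q s & is_name Q t].

Lemma name_cond s u r : is_name Q s -> opair u r ∈ s -> r ∈ Q /\ is_name Q u.
Proof.
case=> H H' urs; split; last exact: H' urs.
by have [u' [r' [r'Q /opair_inj [_ ->]]]] := H _ urs.
Qed.

(** Lift [q] to some [q'] below [p]. As [pr q'] lies below [q], hence below [r], [pr_below] puts
    [q'] below [r]. The hypothesis applies at [q'], and its witness is projected back. *)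
Lemma sub_step_proj (F G : V -> V -> V -> Prop) p s t :
  (forall x u v, x ∈ P -> is_name Q u -> is_name Q v -> F x u v -> G (pr x) u v) ->
  p ∈ P -> is_name Q s -> is_name Q t ->
  sub_step M le F p s t -> sub_step M leQ G (pr p) s t.
Proof.
move=> FG pP ns nt H u uM r rM urs q qM qp qr.
have [rQ nu] := name_cond ns urs.
have [q' [q'p q'q]] := pr_lift pP qp; have [q'M q'P] := leM q'p.
have q'r : leq_in le q' r by apply: pr_below => //; apply: leQ_trans q'q qr.
have [x [xM [xq' [v [vM [w [wM [vwt [xw Fx]]]]]]]]] := H u uM r rM urs q' q'M q'p q'r.
have [wQ nv] := name_cond nt vwt.
have [_ xP] := leM xq'.
have xq := leQ_trans (pr_mono xq') q'q.
exists (pr x); split; first exact: leQM xq; split=> //.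
exists v; split=> //; exists w; do !split=> //; last exact: FG.
by rewrite -(pr_id wQ); apply: pr_mono.
Qed.

(** A witness [x] below [pr q] lifts only to a condition whose projection is below [x], possibly
    different from it. Hence the premise passes from [x] to any [y] projecting below [x]. *)
Lemma sub_step_lift (F G : V -> V -> V -> Prop) p s t :
  (forall x y u v, y ∈ P -> is_name Q u -> is_name Q v -> leq_in leQ (pr y) x ->
    G x u v -> F y u v) ->
  p ∈ P -> is_name Q s -> is_name Q t ->
  sub_step M leQ G (pr p) s t -> sub_step M le F p s t.
Proof.
move=> GF pP ns nt H u uM r rM urs q qM qp qr.
have [rQ nu] := name_cond ns urs; have [_ qP] := leM qp.
have Hr := pr_mono qr; rewrite (pr_id rQ) in Hr; have Hp := pr_mono qp.
have [x [xM [xq [v [vM [w [wM [vwt [xw Gx]]]]]]]]] := H u uM r rM urs _ (leQM Hp) Hp Hr.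
have [wQ nv] := name_cond nt vwt.
have [q' [q'q q'x]] := pr_lift qP xq; have [q'M q'P] := leM q'q.
exists q'; split=> //; split=> //; exists v; split=> //; exists w; do !split=> //.
- by apply: pr_below => //; apply: leQ_trans q'x xw.
- exact: GF q'x Gx.
Qed.

(** Coinduction in both directions, with the image and the preimage of forced equality under [pr] as
    post-fixed relations. Restricting them to names over [Q] keeps the conditions occurring in the
    names where [pr] is the identity. *)
Lemma force_eq_proj p s t : p ∈ P -> is_name Q s -> is_name Q t ->
  force_eq M le p s t <-> force_eq M leQ (pr p) s t.
Proof.
move=> pP ns nt; split=> H.
  exists (fun x u v => exists y, [/\ y ∈ P, x = pr y & names_rel (force_eq M le) y u v]).
  split; last by exists p.
  move=> _ u v [y [yP -> [Fy nu nv]]]; have /force_eqE [H1 H2] := Fy; split.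
    by apply: sub_step_proj H1 => // x u' v' xP nu' nv' Fx; exists x.
  by apply: sub_step_proj H2 => // x u' v' xP nu' nv' Fx; exists x.
exists (fun y u v => y ∈ P /\ names_rel (force_eq M leQ) (pr y) u v).
split=> // y u v [yP [Fy nu nv]]; have /force_eqE [H1 H2] := Fy; split.
  apply: sub_step_lift H1 => // x z u' v' zP nu' nv' zx Gx; do 2!split=> //.
  exact: force_eq_weaken zx Gx.
apply: sub_step_lift H2 => // x z u' v' zP nu' nv' zx Gx; do 2!split=> //.
exact: force_eq_weaken zx Gx.
Qed.

End Projection.

(** * Names inside the model *)

Section Names.
Variables M C : V.
Hypothesis hM : ctm_GBm M C.

(** Such an [N] is closed under subnames and so certifies that its members are names over [D]; it
    stands in for the recursion that defines names. *)
Definition supports (D N : V) : Prop :=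
  forall y, y ∈ N -> forall z, z ∈ y ->
  exists t, t ∈ N /\ exists p, p ∈ M /\ (p ∈ D /\ z = opair t p).

Lemma dfn_supports : dfn M C (fun r => supports (r 0) (r 1)).
Proof. dfn_tac. Qed.

Lemma dfn_supports_class D : D ∈ C -> dfn M C (fun r => supports D (r 0)).
Proof. move=> DC; dfn_tac. Qed.

Lemma supports_name D N y : supports D N -> y ∈ N -> is_name D y.
Proof.
move=> sN; elim/(well_founded_ind (in_name_dom_wf D)): y => y IH yN.
have E z : z ∈ y -> exists t p, [/\ t ∈ N, p ∈ D & z = opair t p].
  by move=> zy; have [t [tN [p [_ [pD ->]]]]] := sN _ yN _ zy; exists t, p.
split; first by move=> z /E [t [p [_ pD ->]]]; exists t, p.
move=> t p tpy; have [t' [p' [t'N p'D /opair_inj [tE pE]]]] := E _ tpy; subst t' p'.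
by apply: IH => //; apply/in_name_domE; exists p.
Qed.

Lemma supports_union D b :
  (forall N, N ∈ b -> supports D N) -> supports D (union b).
Proof.
move=> H y /in_union [N [Nb yN]] z zy.
have [t [tN Ht]] := H _ Nb _ yN _ zy; exists t; split=> //.
by apply/in_union; exists N.
Qed.

(** Induction on the name: [directed_coll] merges the certificates of the subnames, and adjoining
    [s] itself completes the set. *)
Lemma name_supports D s : dfn M C (fun r => supports D (r 0)) -> is_name D s ->
  s ∈ M -> exists N, [/\ N ∈ M, supports D N & s ∈ N].
Proof.
move=> dD; elim=> {}s H _ IH sM.
have [|||z zs|N [NM sN HN]] := directed_coll hM (K := supports D)
    (R := fun z N => exists t, t ∈ M /\ exists p, p ∈ M /\ (z = opair t p /\ t ∈ N)) sM dD.
- dfn_tac.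
- exact: supports_union.
- move=> z N N' NN' [t [tM [p [pM [zE tN]]]]].
  by exists t; split=> //; exists p; do !split=> //; apply: NN'.
- have [t [p [pD zE]]] := H _ zs.
  have [tM pM] : t ∈ M /\ p ∈ M by apply: (opair_in_M hM _ sM); rewrite -zE.
  have [|N [NM sN tN]] := IH t p _ tM; first by rewrite -zE.
  by exists N; split=> //; exists t; split=> //; exists p.
exists (adjoin N s); split; [exact: (M_adjoin hM)| |by apply/in_adjoin; right].
move=> y /in_adjoin [yN z zy|-> z zs].
  have [t [tN Ht]] := sN _ yN _ zy; exists t; split=> //.
  by apply/in_adjoin; left.
have [t [tM [p [pM [zE tN]]]]] := HN _ zs.
exists t; split; first by apply/in_adjoin; left.
exists p; split=> //; split=> //.
by have [t' [p' [p'D]]] := H _ zs; rewrite zE => /opair_inj [_ ->].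
Qed.

(** The inductive predicate lives in the ambient universe; certificates in [M] turn it into an
    existential statement over the model. *)
Lemma dfn_is_name D : D ∈ C -> dfn M C (fun r => is_name D (r 0)).
Proof.
move=> DC; apply: (dfn_ext (Q := fun r => exists N, N ∈ M /\ (supports D N /\ r 0 ∈ N))).
  move=> r rM; split=> [[N [NM [sN xN]]]|nx]; first exact: supports_name sN xN.
  have [N [NM sN xN]] := name_supports (dfn_supports_class DC) nx (rM 0).
  by exists N.
apply: dfn_ex; apply: dfn_and; last by dfn_tac.
exact: dfn_supports_class.
Qed.

End Names.

(** * Forced equality for set orders *)

Section SetForcingEquality.
Variables M C : V.
Hypothesis hM : ctm_GBm M C.

Definition post_fixed_set (le F : V) : Prop :=
  forall p, p ∈ M -> forall s, s ∈ M -> forall t, t ∈ M ->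
  triple_in F p s t -> eq_step M le (triple_in F) p s t.

Definition witnessed_eq (le p s t : V) : Prop :=
  exists F, F ∈ M /\ (post_fixed_set le F /\ triple_in F p s t).

Lemma dfn_post_fixed_set : dfn M C (fun r => post_fixed_set (r 0) (r 1)).
Proof.
rewrite /post_fixed_set /eq_step /sub_step /mem_step /mem_at /flip3 /triple_in; dfn_tac.
Qed.

Lemma dfn_witnessed_eq le : le ∈ M -> 
  dfn M C (fun r => witnessed_eq le (r 0) (r 1) (r 2)).
Proof.
move=> leM; apply: dfn_ex; apply: dfn_and; last by rewrite /triple_in; dfn_tac.
by apply: (dfn_sub2 dfn_post_fixed_set); dfn_tac.
Qed.

Lemma force_eq_of_witness le p s t : p ∈ M -> s ∈ M -> t ∈ M ->
  witnessed_eq le p s t -> force_eq M le p s t.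
Proof.
move=> pM sM tM [F [FM [pF Fp]]].
(* [F] is known to be post-fixed only at triples from [M], so the relation carries these memberships
   along. *)
exists (fun p s t => [/\ p ∈ M, s ∈ M & t ∈ M] /\ triple_in F p s t); split=> //.
move=> x u v [[xM uM vM] Fx]; have [H H'] := pF x xM u uM v vM Fx.
have sub G u' v' : v' ∈ M -> sub_step M le G x u' v' ->
    sub_step M le (fun x u v => [/\ x ∈ M, u ∈ M & v ∈ M] /\ G x u v) x u' v'.
  move=> v'M HG w wM r rM wru q qM qx qr.
  have [y [yM [yq [z [zM [k [kM [zkv [yk Gy]]]]]]]]] := HG w wM r rM wru q qM qx qr.
  by exists y; split=> //; split=> //; exists z; split=> //; exists k; do !split.
split; first exact: sub.
apply: sub_step_mono (sub _ _ _ uM H') => w r y z _ [[yM wM zM] Gy].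
by split.
Qed.

Lemma post_fixed_set_mono le F F' p s t : F ⊆ F' ->
  eq_step M le (triple_in F) p s t -> eq_step M le (triple_in F') p s t.
Proof. by move=> FF'; apply: eq_step_mono => x u v; apply: FF'. Qed.

Lemma post_fixed_set_union le b :
  (forall F, F ∈ b -> post_fixed_set le F) -> post_fixed_set le (union b).
Proof.
move=> H p pM s sM t tM /in_union [F [Fb Fp]].
apply: post_fixed_set_mono (H F Fb p pM s sM t tM Fp).
by move=> z zF; apply/in_union; exists F.
Qed.

(** One use of [directed_coll] per coordinate avoids forming the product of [a], [b] and [c]. The
    demand is an implication, so that a triple without a witness asks for nothing. *)
Lemma witness_triples le a b c : le ∈ M -> a ∈ M -> b ∈ M -> c ∈ M ->
  exists F, [/\ F ∈ M, post_fixed_set le F & forall p s t, p ∈ a -> s ∈ b -> t ∈ c ->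
    witnessed_eq le p s t -> triple_in F p s t].
Proof.
move=> leM aM bM cM.
have Kd : dfn M C (fun r => post_fixed_set le (r 0)).
  by apply: (dfn_sub2 dfn_post_fixed_set); dfn_tac.
pose W F p s t := witnessed_eq le p s t -> triple_in F p s t.
have Wmono F F' p s t : F ⊆ F' -> W F p s t -> W F' p s t.
  by move=> FF' h /h; apply: FF'.
have Wdfn f p s t : dterm M C f -> dterm M C p -> dterm M C s -> dterm M C t ->
    dfn M C (fun r => W (f r) (p r) (s r) (t r)).
  move=> fd pd sd td; apply: dfn_imp; last by rewrite /triple_in; dfn_tac.
  exact: (dfn_sub3 (dfn_witnessed_eq leM)).
have ex1 p s t : exists F, [/\ F ∈ M, post_fixed_set le F & W F p s t].
  have [[F [FM [pF Fp]]]|n] := pselect (witnessed_eq le p s t).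
    by exists F; split=> // _.
  (* The empty set, obtained by Separation, is vacuously post-fixed. *)
  exists (sep le (fun=> False)); split=> //.
    by apply: (M_sep hM leM); apply: dfn_Prop.
  by move=> p' _ s' _ t' _ /in_sep [].
have ex2 p s : p ∈ M -> s ∈ M ->
    exists F, [/\ F ∈ M, post_fixed_set le F & forall t, t ∈ c -> W F p s t].
  move=> pM sM; apply: (directed_coll hM (R := fun t F => W F p s t) cM Kd).
  - by apply: Wdfn; dfn_tac.
  - exact: post_fixed_set_union.
  - by move=> t F F'; apply: Wmono.
  - by move=> t _; apply: ex1.
have ex3 p : p ∈ M ->
    exists F, [/\ F ∈ M, post_fixed_set le F & forall s, s ∈ b -> forall t, t ∈ c -> W F p s t].
  move=> pM.
  apply: (directed_coll hM (R := fun s F => forall t, t ∈ c -> W F p s t) bM Kd).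
  - by apply: dfn_allin => //; [dfn_tac|apply: Wdfn; dfn_tac].
  - exact: post_fixed_set_union.
  - by move=> s F F' FF' h t tc; apply: Wmono FF' (h t tc).
  - by move=> s sb; apply: ex2 => //; apply: mem_M hM _ _ sb bM.
have [|||p pa|F [FM pF HF]] := directed_coll hM
    (R := fun p F => forall s, s ∈ b -> forall t, t ∈ c -> W F p s t) aM Kd.
- by apply: dfn_allin => //; [dfn_tac|apply: dfn_allin => //; [dfn_tac|apply: Wdfn; dfn_tac]].
- exact: post_fixed_set_union.
- by move=> p F F' FF' h s sb t tc; apply: Wmono FF' (h s sb t tc).
- by apply: ex3; apply: mem_M hM _ _ pa aM.
by exists F; split=> // p s t pa sb tc; apply: HF.
Qed.

(** The step at a triple consults only subnames of [s] and [t], at conditions in the field of [le].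
    By induction on [s] the equalities forced there have witnesses; one set [F] contains them all,
    and adding the triple itself keeps it post-fixed. *)
Lemma witness_of_force_eq le D p s t : le ∈ M -> is_name D s -> p ∈ M -> s ∈ M -> t ∈ M ->
  force_eq M le p s t -> witnessed_eq le p s t.
Proof.
move=> leM ns; elim: ns p t => {}s _ _ IH p t pM sM tM /force_eqE st.
have UU x : x ∈ M -> union (union x) ∈ M by move=> xM; do 2!apply: (M_union hM).
(* With Kuratowski pairs, conditions and subnames are found two unions below [le], [s] and [t]. *)
have [F [FM pF HF]] := witness_triples leM (UU _ leM) (UU _ sM) (UU _ tM).
pose F' := adjoin F (opair p (opair s t)).
have stF : eq_step M le (triple_in F) p s t.
  have W q u v r w : opair u r ∈ s -> opair v w ∈ t -> q ∈ M -> q ∈ union (union le) ->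
      force_eq M le q u v -> triple_in F q u v.
    move=> us vt qM qle e; have [uM _] := opair_in_M hM us sM.
    have [vM _] := opair_in_M hM vt tM.
    apply: HF => //; first by have [] := in_opair_union2 us.
      by have [] := in_opair_union2 vt.
    exact: IH us _ _ qM uM vM e.
  case: st => H H'; split=> u uM r rM us q qM qp qr.
    have [y [yM [yq [z [zM [k [kM [zkv [yk Gy]]]]]]]]] := H u uM r rM us q qM qp qr.
    exists y; split=> //; split=> //; exists z; split=> //; exists k; do !split=> //.
    by apply: W us zkv _ _ Gy => //; have [] := in_opair_union2 yq.
  have [y [yM [yq [z [zM [k [kM [zkv [yk Gy]]]]]]]]] := H' u uM r rM us q qM qp qr.
  exists y; split=> //; split=> //; exists z; split=> //; exists k; do !split=> //.
  by apply: W zkv us _ _ Gy => //; have [] := in_opair_union2 yq.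
have FF' : F ⊆ F' by move=> z zF; apply/in_adjoin; left.
exists F'; split; first by do ?apply: (M_adjoin hM) => //; do 2?apply: (M_opair hM).
split; last by apply/in_adjoin; right.
move=> p' p'M s' s'M t' t'M /in_adjoin [Fp'|/opair_inj [-> /opair_inj [-> ->]]].
  exact: post_fixed_set_mono FF' (pF p' p'M s' s'M t' t'M Fp').
exact: post_fixed_set_mono FF' stF.
Qed.

End SetForcingEquality.

(** * Definability of forced equality for the class forcing *)

Lemma is_name_sub D D' s : D ⊆ D' -> is_name D s -> is_name D' s.
Proof.
move=> DD'; elim=> {}s H _ IH; split=> // z /H [t [p [pD ->]]].
by exists t, p; split=> //; apply: DD'.
Qed.

Lemma in_induced_le P Q p q : leq_in (induced_le P Q) p q <->
  [/\ leq_in (fle P) p q, p ∈ Q & q ∈ Q].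
Proof.
rewrite /leq_in in_sep; split=> [[h [p' [q' [p'Q q'Q]]]]|[h pQ qQ]].
  by move=> /opair_inj [pE qE]; subst p' q'.
by split=> //; exists p, q.
Qed.

Section ForcingEqualityDefinable.
Variables (M C : V) (P : forcing).
Hypothesis hM : ctm_GBm M C.
Hypothesis hP : class_forcing C P.

Lemma cond_M p : p ∈ fdom P -> p ∈ M.
Proof. by case: hP => DC _ _; apply: class_M hM _ _ DC. Qed.

Lemma leq_cond p q : leq_in (fle P) p q -> p ∈ fdom P /\ q ∈ fdom P.
Proof. by case: hP => _ _ po; apply: po_in po. Qed.

Lemma leq_trans_P p q r : leq_in (fle P) p q -> leq_in (fle P) q r -> leq_in (fle P) p r.
Proof. by case: hP => _ _ po; apply: po_leq_trans po. Qed.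

Lemma dfn_ordinal_set : dfn M C (fun r => ordinal_set (r 0)).
Proof.
apply: (dfn_ext (Q := fun r => (forall y, y ∈ r 0 -> forall z, z ∈ y -> z ∈ r 0) /\
  (forall y, y ∈ r 0 -> forall z, z ∈ y -> forall w, w ∈ z -> w ∈ y))).
  by move=> r _; rewrite ordinal_setE.
dfn_tac.
Qed.

(* [force_eq] is only controlled on names; with this restriction the relation is
   definable for all arguments in [M]. *)
Definition proper_force_eq (p s t : V) : Prop :=
  p ∈ fdom P /\ (is_name (fdom P) s /\ (is_name (fdom P) t /\
    force_eq M (fle P) p s t)).

Lemma dfn_proper_force_eq : approachable_by_projections M C P ->
  dfn M C (fun r => proper_force_eq (r 0) (r 1) (r 2)).
Proof.
have [DC lC po] := hP.
move=> [Pa [[Pset [G1 [G1C G1E]] Pmono _ Pun] [pi [piP [G2 [G2C G2E]] piE]]]].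
have G1P a Q l : opair a (opair Q l) ∈ G1 <->
    [/\ in_Ord M a, Q = Pa a & l = induced_le P (Pa a)].
  rewrite G1E; split=> [[a' [oa /opair_inj [-> /opair_inj [-> ->]]]]|[oa -> ->]] //.
  by exists a.
have G2P a p x : opair a (opair p x) ∈ G2 <-> [/\ in_Ord M a, p ∈ fdom P & x = pi a p].
  rewrite G2E; split=> [[a' [p' [oa pP /opair_inj [-> /opair_inj [-> ->]]]]]|[oa pP ->]] //.
  by exists a, p.
have Osucc a : in_Ord M a -> in_Ord M (succ a).
  by move=> [aM oa]; split; [exact: (M_succ hM)|exact: ordinal_succ].
have PaM a : in_Ord M a -> Pa a ∈ M /\ induced_le P (Pa a) ∈ M.
  by move=> /Pset [t [_ /= /(M_opairP hM)]].
have PaP a : in_Ord M a -> Pa a ⊆ fdom P by move=> oa p pa; apply/Pun; exists a.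
have proj a p s t : in_Ord M a -> p ∈ fdom P -> is_name (Pa a) s -> is_name (Pa a) t ->
    force_eq M (fle P) p s t <->
    force_eq M (induced_le P (Pa (succ a))) (pi a p) s t.
  move=> oa; have [_ h2 h3 h4 h5] := piE a oa.
  apply: force_eq_proj.
  - by move=> x y /leq_cond [xP _]; split=> //; apply: cond_M.
  - by move=> x y /in_induced_le [/leq_cond [/cond_M]].
  - move=> x y z /in_induced_le [xy xQ yQ] /in_induced_le [yz _ zQ].
    by apply/in_induced_le; split=> //; apply: leq_trans_P yz.
  - move=> x y xy; have [xP yP] := leq_cond xy.
    by apply/in_induced_le; split; [exact: h2|exact: piP|exact: piP].
  - move=> x y xP yx; have [r [rx ry]] := h3 x y xP yx.
    exists r; split=> //; have [rP _] := leq_cond rx.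
    by have /in_induced_le [_ yQ _] := yx; apply/in_induced_le; split=> //; apply: piP.
  - by move=> x y xQ yP /in_induced_le [yx _ _]; apply: h4.
  - exact: h5.
(* Both names live at a common stage: Collection bounds the stages of the conditions occurring in a
   set that supports both. *)
have stage s t : s ∈ M -> t ∈ M -> is_name (fdom P) s -> is_name (fdom P) t ->
    exists a, in_Ord M a /\ exists N, N ∈ M /\ (supports M (Pa a) N /\ (s ∈ N /\ t ∈ N)).
  move=> sM tM ns nt.
  have [N1 [N1M sN1 sN]] := name_supports hM (dfn_supports_class hM DC) ns sM.
  have [N2 [N2M sN2 tN]] := name_supports hM (dfn_supports_class hM DC) nt tM.
  pose N := union (upair N1 N2).
  have NM : N ∈ M by apply: (M_union hM); apply: (M_upair hM).
  have suppN : supports M (fdom P) N by apply: supports_union => N' /in_upair [->|->].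
  (* Stages are mentioned through the class [G1], since [Pa] is a function of the ambient
     universe. *)
  pose R z a := forall u, u ∈ M -> forall p, p ∈ M -> z = opair u p ->
    exists b, b ∈ a /\ exists Q, Q ∈ M /\ exists l, l ∈ M /\
      (opair b (opair Q l) ∈ G1 /\ p ∈ Q).
  have Rd : dfn M C (fun r => R (r 0) (r 1)) by rewrite /R; dfn_tac.
  have [|||a [aM oa Ha]] := directed_coll hM (K := ordinal_set) (R := R) (M_union hM NM)
    dfn_ordinal_set Rd.
  - exact: ordinal_union.
  - move=> z F F' FF' h u uM p pM zE; have [b [bF H]] := h u uM p pM zE.
    by exists b; split=> //; apply: FF'.
  - move=> z /in_union [y [yN zy]].
    have [u [_ [p [_ [/Pun [a [oa pa]] zE]]]]] := suppN _ yN _ zy.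
    have [sa sO] := Osucc a oa; have [QM lM] := PaM a oa.
    (* The successor is taken because [R] asks for an index that is a member of its second
       argument. *)
    exists (succ a); split=> // u' _ p' _; rewrite zE => /opair_inj [_ <-].
    exists a; split; first by apply/in_succ; right.
    exists (Pa a); split=> //; exists (induced_le P (Pa a)); split=> //.
    by split=> //; apply/G1P.
  exists a; split=> //; exists N; split=> //; split; last first.
    by split; apply/in_union; [exists N1|exists N2]; split=> //; apply/in_upair; [left|right].
  move=> y yN z zy; have [u [uN [p [pM [pP zE]]]]] := suppN _ yN _ zy.
  exists u; split=> //; exists p; split=> //; split=> //.
  have zU : z ∈ union N by apply/in_union; exists y.
  have [b [ba [Q [_ [l [_ [/G1P [ob -> _] pb]]]]]]] := Ha z zU u (mem_M hM uN NM) p pM zE.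
  by apply: Pmono pb.
(* [dfn_witnessed_eq] fixes the order as a parameter, whereas here it varies with the stage. *)
have dW l x s t : dterm M C l -> dterm M C x -> dterm M C s -> dterm M C t ->
    dfn M C (fun r => witnessed_eq M (l r) (x r) (s r) (t r)).
  move=> ld xd sd td; apply: dfn_ex; apply: dfn_and.
    apply: (dfn_sub2 (dfn_post_fixed_set hM)); last exact: dterm_var.
    exact: (@dterm_ren _ _ S _ ld).
  apply: dfn_mem; last exact: dterm_var.
  apply: (dterm_opair hM); first exact: (@dterm_ren _ _ S _ xd).
  by apply: (dterm_opair hM); [exact: (@dterm_ren _ _ S _ sd)|exact: (@dterm_ren _ _ S _ td)].
have dS Q N : dterm M C Q -> dterm M C N -> dfn M C (fun r => supports M (Q r) (N r)).
  by apply: dfn_sub2; apply: dfn_supports.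
(* The defining formula: [Q] is stage [a], [N] certifies both names over it, [l'] is the order of
   the next stage, and [x] is the projected condition, for which a set witness exists. *)
have Phid : dfn M C (fun r => exists a, a ∈ M /\ exists Q, Q ∈ M /\ exists l, l ∈ M /\
    (opair a (opair Q l) ∈ G1 /\
    ((exists N, N ∈ M /\ (supports M Q N /\ (r 1 ∈ N /\ r 2 ∈ N))) /\
    exists Q', Q' ∈ M /\ exists l', l' ∈ M /\ (opair (succ a) (opair Q' l') ∈ G1 /\
    exists x, x ∈ M /\ (opair a (opair (r 0) x) ∈ G2 /\
    witnessed_eq M l' x (r 1) (r 2)))))).
  by dfn_tac_with ltac:(first [apply: dS | apply: dW]).
apply: dfn_ext Phid => r rM.
have [pM sM tM] : [/\ r 0 ∈ M, r 1 ∈ M & r 2 ∈ M] by [].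
split.
  move=> [a [aM [Q [QM [l [lM [/G1P [oa QE _] [[N [NM [suN [sN tN]]]]]]]]]]]].
  move=> [Q' [Q'M [l' [l'M [/G1P [soa Q'E l'E] [x [xM [/G2P [_ pP xE] W]]]]]]]].
  subst Q Q' l' x.
  have ns := supports_name suN sN; have nt := supports_name suN tN.
  split; first exact: pP.
  split; first exact: is_name_sub (PaP a oa) ns.
  split; first exact: is_name_sub (PaP a oa) nt.
  apply/(proj _ _ _ _ oa pP ns nt); exact: force_eq_of_witness xM sM tM W.
move=> [pP [ns [nt H]]].
have [a [oa [N [NM [suN [sN tN]]]]]] := stage _ _ sM tM ns nt.
have [QM lM] := PaM a oa; have [Q'M l'M] := PaM _ (Osucc a oa).
have ns' := supports_name suN sN; have nt' := supports_name suN tN.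
exists a; split; first by case: oa.
exists (Pa a); split=> //; exists (induced_le P (Pa a)); split=> //.
split; first exact/G1P.
split; first by exists N.
exists (Pa (succ a)); split=> //; exists (induced_le P (Pa (succ a))); split=> //.
split; first by apply/G1P; split=> //; apply: Osucc.
have xM : pi a (r 0) ∈ M by apply: (mem_M hM) Q'M; apply: piP.
exists (pi a (r 0)); split=> //; split; first exact/G2P.
apply: (witness_of_force_eq hM l'M ns' xM sM tM).
exact/(proj _ _ _ _ oa pP ns' nt').
Qed.

End ForcingEqualityDefinable.

(** * Truth and definability for all formulas *)

(** Rasiowa-Sikorski: a descending sequence meets the countably many dense classes, and its upward
    closure is the filter. *)
Lemma generic_exists C P p : countable_set C -> class_forcing C P -> p ∈ fdom P ->
  exists G, generic C P G /\ p ∈ G.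
Proof.
move=> /countable_injP [f finj] [_ _ po] pP.
(* A left inverse, on [C], of the injection [f] into the natural numbers. *)
have [e He] : exists e : nat -> V, forall D, D ∈ C -> e (f D) = D.
  suff /choice [e He] : forall n, exists D', forall D, D ∈ C -> f D = n -> D' = D.
    by exists e => D DC; apply: He.
  move=> n; have [[D [DC fD]]|H] := pselect (exists D, D ∈ C /\ f D = n).
    by exists D => D' D'C fD'; apply: finj; rewrite ?inE // fD fD'.
  by exists empty => D DC fD; case: H; exists D.
(* Where the class with index [np.1] is not dense, the condition is simply kept. *)
have [nxt Hnxt] : exists nxt : nat * V -> V, forall np, np.2 ∈ fdom P ->
    leq_in (fle P) (nxt np) np.2 /\ (dense P (e np.1) -> nxt np ∈ e np.1).
  suff /choice [nxt H] : forall np : nat * V, exists q, np.2 ∈ fdom P ->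
      leq_in (fle P) q np.2 /\ (dense P (e np.1) -> q ∈ e np.1) by exists nxt.
  move=> [n x] /=; have [[_ H]|nd] := pselect (dense P (e n)).
    have [xP|nx] := pselect (x ∈ fdom P); last by exists x.
    by have [q [qe qx]] := H x xP; exists q.
  by exists x => xP; split=> //; apply: po_refl po _ xP.
pose ps := fix ps n := if n is k.+1 then nxt (k, ps k) else p.
have psP n : ps n ∈ fdom P.
  elim: n => [|n IH] //=; have [h _] := Hnxt (n, ps n) IH.
  by have [] := po_in po h.
have psS n : leq_in (fle P) (ps n.+1) (ps n) by have [] := Hnxt (n, ps n) (psP n).
have psle m n : m <= n -> leq_in (fle P) (ps n) (ps m).
  move=> /subnK <-; elim: (n - m) => [|k IH]; first exact: po_refl po _ (psP m).
  by rewrite addSn; apply: po_leq_trans po (psS _) IH.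
pose G := sep (fdom P) (fun q => exists n, leq_in (fle P) (ps n) q).
have psG n : ps n ∈ G.
  by apply/in_sep; split=> //; exists n; apply: po_refl po _ (psP n).
exists G; split; last exact: (psG 0).
split; first split.
- by move=> q /in_sep [].
- by exists p; apply: (psG 0).
- move=> q r /in_sep [qP [n hn]] rP qr; apply/in_sep; split=> //.
  by exists n; apply: po_leq_trans po hn qr.
- move=> q r /in_sep [qP [n hn]] /in_sep [rP [m hm]].
  exists (ps (maxn n m)); split=> //.
    by apply: po_leq_trans po (psle _ _ (leq_maxl n m)) hn.
  by apply: po_leq_trans po (psle _ _ (leq_maxr n m)) hm.
(* The class with index [k] is met at position [k.+1] of the sequence. *)
- move=> D DC dD; exists (ps (f D).+1); split; last exact: psG.
  by have [_] := Hnxt (f D, ps (f D)) (psP _); rewrite /= He //; apply.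
Qed.

(** * The forcing theorem from the definability of forced equality *)

Section ForcingTheorem.
Variables (M C : V) (P : forcing).
Hypothesis hM : ctm_GBm M C.
Hypothesis hP : class_forcing C P.
Local Notation val := Defs.val.
Local Notation fE := (proper_force_eq M P).
Local Notation le := (fle P).
Local Notation name := (is_name (fdom P)).
Hypothesis hE : dfn M C (fun r => fE (r 0) (r 1) (r 2)).

Lemma set_class x : x ∈ M -> x ∈ C.
Proof.
move=> xM; have [|z zx|X [XC XE]] := compr hM (Q := fun z => z ∈ x).
- by apply: dfn_mem; [apply: dterm_var|apply: dterm_const].
- exact: mem_M hM _ _ zx xM.
by rewrite -(V_extensionality XE).
Qed.

(** The conditions that satisfy [Q] or are incompatible with [p] form a dense class. The generic
    filter meets it, and no member of the filter is incompatible with [p]. *)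
Lemma generic_below G (Q : V -> Prop) p : generic C P G -> p ∈ G ->
  dfn M C (fun r => Q (r 0)) ->
  (forall q, leq_in le q p -> exists s, leq_in le s q /\ Q s) ->
  exists s, s ∈ G /\ Q s.
Proof.
move=> [[GP _ _ Gdir] Gden] pG Qd H; have [DC lC po] := hP.
have pM : p ∈ M by apply: (cond_M hM hP); apply: GP.
have [|z [zP _]|D [DinC DE]] := compr hM (Q := fun x => x ∈ fdom P /\
  (Q x \/ forall t, t ∈ M -> leq_in le t x -> ~ leq_in le t p)).
- by dfn_tac.
- exact: (cond_M hM hP zP).
have [|s [/DE [sP sQ] sG]] := Gden D DinC.
  split=> [x /DE [] //|x xP].
  have [[t [tx tp]]|n] := pselect (exists t, leq_in le t x /\ leq_in le t p).
    have [s [st Qs]] := H t tp; exists s; split; last exact: (leq_trans_P hP) tx.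
    by apply/DE; split; [have [] := leq_cond hP st|left].
  exists x; split; last exact: po_refl po _ xP.
  by apply/DE; split=> //; right=> t tM tx tp; apply: n; exists t.
case: sQ => [Qs|ns]; first by exists s.
have [t [tG ts tp]] := Gdir _ _ sG pG.
by case: (ns t (cond_M hM hP (GP _ tG)) ts tp).
Qed.

Lemma mem_at_intro (F : V -> V -> V -> Prop) q s t u r : t ∈ C -> opair u r ∈ t ->
  leq_in le q r -> F q s u -> mem_at M le F q s t.
Proof.
move=> tC urt qr Fq; have [uM rM] := M_opairP hM (class_M hM tC urt).
exists u; split; first exact: uM.
exists r; split; first exact: rM.
split; first exact: urt.
split; [exact: qr|exact: Fq].
Qed.

Lemma dfn_mem_at_class F t : t ∈ C -> dfn M C (fun r => F (r 0) (r 1) (r 2)) ->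
  dfn M C (fun r => mem_at M le F (r 0) (r 1) t).
Proof.
have [DC lC po] := hP; move=> tC Fd0.
have Fd s t' u := @dfn_sub3 _ _ F s t' u Fd0.
by rewrite /mem_at; dfn_tac_with ltac:(apply: Fd).
Qed.

Lemma dfn_flip : dfn M C (fun r => flip3 fE (r 0) (r 1) (r 2)).
Proof. by rewrite /flip3; apply: (dfn_sub3 hE); apply: dterm_var. Qed.

Lemma generic_mem_at G F p s t : generic C P G -> p ∈ G ->
  dfn M C (fun r => F (r 0) (r 1) (r 2)) -> s ∈ M -> t ∈ C ->
  (forall q, q ∈ M -> leq_in le q p -> mem_step M le F q s t) ->
  exists q u r, [/\ q ∈ G, r ∈ G, opair u r ∈ t, u ∈ M & F q s u].
Proof.
move=> gG pG Fd sM tC H; have [[GP _ Gup _] _] := gG.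
have [||q [qG [u [uM [r [rM [urt [qr Fq]]]]]]]] :=
  generic_below (Q := fun q => mem_at M le F q s t) gG pG.
- apply: (@dfn_sub2 _ _ (fun q s => mem_at M le F q s t)).
  + exact: dfn_mem_at_class.
  + exact: dterm_var.
  + exact: dterm_const.
- move=> q qp; have [qP _] := leq_cond hP qp.
  have [q' [q'M [q'q K]]] := H q (cond_M hM hP qP) qp.
  by exists q'.
exists q, u, r; split=> //; have [_ rP] := leq_cond hP qr.
exact: Gup qr.
Qed.

Lemma proper_eq_step p s t : fE p s t -> eq_step M le fE p s t.
Proof.
move=> [pP [ns [nt /force_eqE [H H']]]].
have sub F F' x y : name x -> name y -> sub_step M le F p x y ->
    (forall q u v, q ∈ fdom P -> name u -> name v -> F q u v -> F' q u v) ->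
    sub_step M le F' p x y.
  move=> nx ny K FF' u uM r rM urx q qM qp qr.
  have [q' [q'M [q'q [v [vM [w [wM [vwy [q'w Fq]]]]]]]]] := K u uM r rM urx q qM qp qr.
  exists q'; split=> //; split=> //; exists v; split=> //; exists w; do !split=> //.
  have [_ nu] := name_cond nx urx; have [_ nv] := name_cond ny vwy.
  by apply: FF' => //; have [] := leq_cond hP q'q.
split.
  by apply: sub ns nt H _ => q u v qP nu nv h; split.
by apply: sub nt ns H' _ => q u v qP nu nv h; split.
Qed.

Lemma proper_of_eq_step p s t : p ∈ fdom P -> name s -> name t ->
  eq_step M le fE p s t -> fE p s t.
Proof.
move=> pP ns nt H; split; first exact: pP.
split; first exact: ns.
split; first exact: nt.
by apply/force_eqE; apply: eq_step_mono H => x u v [_ [_ []]].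
Qed.

Lemma fE_weaken p q s t : leq_in le q p -> fE p s t -> fE q s t.
Proof.
move=> qp [pP [ns [nt H]]]; have [qP _] := leq_cond hP qp.
split; first exact: qP.
split; first exact: ns.
split; first exact: nt.
exact: force_eq_weaken (leq_trans_P hP) qp H.
Qed.

(** Induction on [s]. For a subname listed with a condition of [G], genericity yields a partner in
    the other name at a condition of [G], and the induction hypothesis identifies the values. In the
    second inclusion [flip3] keeps the subname of [s] first. *)
Lemma val_eq_of_fE G p s t : generic C P G -> s ∈ M -> t ∈ M -> p ∈ G ->
  fE p s t -> val G s = val G t.
Proof.
move=> gG sM tM pG H; have [_ [ns _]] := H; have [[GP _ Gup Gdir] _] := gG.
elim: ns p t sM tM pG H => {}s _ _ IH p t sM tM pG /proper_eq_step [H H'].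
apply: V_extensionality => x; split=> /in_val.
  move=> [u [r [rG urs ->]]]; have [q [qG qp qr]] := Gdir _ _ pG rG.
  have [uM rM] := opair_in_M hM urs sM.
  have [||q' [v [w [q'G wG vwt vM Fq]]]] := generic_mem_at gG qG hE uM (t := t).
  - exact: set_class.
  - move=> q' q'M q'q.
    exact: (H u uM r rM urs q' q'M (leq_trans_P hP q'q qp) (leq_trans_P hP q'q qr)).
  rewrite (IH _ _ urs _ _ uM vM q'G Fq); apply/in_val.
  by exists v, w.
move=> [v [w [wG vwt ->]]]; have [q [qG qp qw]] := Gdir _ _ pG wG.
have [vM wM] := opair_in_M hM vwt tM.
have [||q' [u [r [q'G rG urs uM Fq]]]] := generic_mem_at gG qG dfn_flip vM (t := s).
- exact: set_class.
- move=> q' q'M q'q.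
  exact: (H' v vM w wM vwt q' q'M (leq_trans_P hP q'q qp) (leq_trans_P hP q'q qw)).
rewrite -(IH _ _ urs _ _ uM vM q'G Fq); apply/in_val.
by exists u, r.
Qed.

(** A definable way to force the failure of an inclusion: [p] puts [u] into [s], and nothing below
    [p] puts it into [t]. *)
Definition not_sub (F : V -> V -> V -> Prop) (p s t : V) : Prop :=
  exists u, u ∈ M /\ exists r, r ∈ M /\ (opair u r ∈ s /\ (leq_in le p r /\
    forall q, q ∈ M -> leq_in le q p -> ~ mem_at M le F q u t)).

Lemma dfn_not_sub F s t : s ∈ M -> t ∈ M -> dfn M C (fun r => F (r 0) (r 1) (r 2)) ->
  dfn M C (fun r => not_sub F (r 0) s t).
Proof.
have [DC lC po] := hP; move=> sM tM /(dfn_mem_at_class (set_class tM)) Fd0.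
have Fd x y := @dfn_sub2 _ _ (fun x y => mem_at M le F x y t) x y Fd0.
by rewrite /not_sub; dfn_tac_with ltac:(apply: Fd).
Qed.

Lemma not_sub_step F p s t : ~ sub_step M le F p s t ->
  exists q, leq_in le q p /\ not_sub F q s t.
Proof.
move=> H; apply: contrapT => K; apply: H => u uM r rM urs q qM qp qr.
apply: contrapT => L; apply: K; exists q; split=> //.
exists u; split=> //; exists r; do !split=> //.
by move=> q' q'M q'q Hq; apply: L; exists q'.
Qed.

(** Densely often, equality is forced or an inclusion is refuted by [not_sub]. A refutation in [G]
    is impossible: equality of the values and the induction hypothesis give a condition of [G] that
    contradicts it. *)
Lemma fE_of_val_eq G s t : generic C P G -> s ∈ M -> t ∈ M -> name s -> name t ->
  val G s = val G t -> exists p, p ∈ G /\ fE p s t.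
Proof.
move=> gG sM tM ns; have [[GP [p0 p0G] Gup Gdir] _] := gG; have [_ _ po] := hP.
elim: ns t sM tM => {}s N1 N2 IH t sM tM nt E; have ns := IsName N1 N2.
have [||p [pG]] := generic_below
  (Q := fun p => fE p s t \/ (not_sub fE p s t \/ not_sub (flip3 fE) p t s)) gG p0G.
- apply: dfn_or; first by apply: (dfn_sub3 hE); [apply: dterm_var|apply: dterm_const..].
  by apply: dfn_or; apply: dfn_not_sub => //; apply: dfn_flip.
- move=> q qp; have [qP _] := leq_cond hP qp.
  have [H|/not_sub_step [r [rq H]]] := pselect (sub_step M le fE q s t); last first.
    by exists r; split=> //; right; left.
  have [H'|/not_sub_step [r [rq H']]] := pselect (sub_step M le (flip3 fE) q t s); last first.
    by exists r; split=> //; right; right.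
  exists q; split; first exact: po_refl po _ qP.
  by left; apply: proper_of_eq_step.
case=> [H|[[u [uM [r [rM [urs [pr K]]]]]]|[v [vM [w [wM [vwt [pw K]]]]]]]].
- by exists p.
- have [_ rP] := leq_cond hP pr; have rG := Gup _ _ pG rP pr.
  have : val G u ∈ val G t by rewrite -E; apply/in_val; exists u, r.
  move=> /in_val [v [w [wG vwt uv]]].
  have [vM wM] := opair_in_M hM vwt tM.
  have [_ nv] := name_cond nt vwt.
  have [x [xG Fx]] := IH _ _ urs _ uM vM nv uv.
  have [y [yG yx yw]] := Gdir _ _ xG wG; have [z [zG zp zy]] := Gdir _ _ pG yG.
  case: (K z) => //; first by apply: (cond_M hM hP); apply: GP.
  apply: (mem_at_intro (set_class tM) vwt (leq_trans_P hP zy yw)).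
  exact: fE_weaken (leq_trans_P hP zy yx) Fx.
- have [_ wP] := leq_cond hP pw; have wG := Gup _ _ pG wP pw.
  have : val G v ∈ val G s by rewrite E; apply/in_val; exists v, w.
  move=> /in_val [u [r [rG urs vu]]].
  have [uM rM] := opair_in_M hM urs sM.
  have [_ nv] := name_cond nt vwt.
  have [x [xG Fx]] := IH _ _ urs _ uM vM nv (esym vu).
  have [y [yG yx yr]] := Gdir _ _ xG rG; have [z [zG zp zy]] := Gdir _ _ pG yG.
  case: (K z) => //; first by apply: (cond_M hM hP); apply: GP.
  apply: (mem_at_intro (set_class sM) urs (leq_trans_P hP zy yr)).
  exact: fE_weaken (leq_trans_P hP zy yx) Fx.
Qed.

(** The target [t] may be a class name, so this serves membership and the predicate symbols alike;
    built on equality, it calls for no recursion of its own. *)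
Definition force_mem (p s t : V) : Prop :=
  forall q, q ∈ M -> leq_in le q p -> mem_step M le fE q s t.

Lemma force_mem_truth G s t : generic C P G -> s ∈ M -> t ∈ C -> name s -> name t ->
  val G s ∈ val G t <-> exists p, p ∈ G /\ force_mem p s t.
Proof.
move=> gG sM tC ns nt; have [[GP [p0 p0G] Gup Gdir] _] := gG; have [_ _ po] := hP.
split=> [/in_val [u [r [rG urt E]]]|[p [pG H]]].
  have [uM rM] := M_opairP hM (class_M hM tC urt).
  have [_ nu] := name_cond nt urt.
  have [x [xG Fx]] := fE_of_val_eq gG sM uM ns nu E.
  have [y [yG yx yr]] := Gdir _ _ xG rG; exists y; split=> // q qM qy.
  exists q; split=> //; have [qP _] := leq_cond hP qy.
  split; first exact: po_refl po _ qP.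
  apply: (mem_at_intro tC urt (leq_trans_P hP qy yr)).
  exact: fE_weaken (leq_trans_P hP qy yx) Fx.
have [q [u [r [qG rG urt uM Fq]]]] := generic_mem_at gG pG hE sM tC H.
by apply/in_val; exists u, r; split=> //; apply: val_eq_of_fE Fq.
Qed.

Lemma force_mem_dense p s t : 
  (forall q, leq_in le q p -> exists r, leq_in le r q /\ force_mem r s t) ->
  force_mem p s t.
Proof.
move=> H q qM qp; have [r [rq Hr]] := H q qp; have [_ _ po] := hP.
have [rP _] := leq_cond hP rq.
have [x [xM [xr K]]] := Hr r (cond_M hM hP rP) (po_refl po rP).
by exists x; split=> //; split=> //; apply: (leq_trans_P hP xr rq).
Qed.

Lemma fE_dense p s t : p ∈ fdom P -> name s -> name t ->
  (forall q, leq_in le q p -> exists r, leq_in le r q /\ fE r s t) -> fE p s t.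
Proof.
move=> pP ns nt H; have [_ _ po] := hP.
have K F x y : (forall q, leq_in le q p -> exists r, leq_in le r q /\ sub_step M le F r x y) ->
    sub_step M le F p x y.
  move=> {}H u uM r rM urx q qM qp qr; have [q' [q'q Hq']] := H q qp.
  have [q'P _] := leq_cond hP q'q.
  have [z [zM [zq' L]]] := Hq' u uM r rM urx q' (cond_M hM hP q'P) (po_refl po q'P)
    (leq_trans_P hP q'q qr).
  by exists z; split=> //; split=> //; apply: (leq_trans_P hP zq' q'q).
by apply: proper_of_eq_step => //; split; apply: K => q /H [r [rq /proper_eq_step []]];
  exists r.
Qed.

(** The usual star relation, free of generic filters. The recursion on formulas runs outside the
    model, so every instance stays first-order definable. *)
Fixpoint fstar n (Gamma : n.-tuple V) m (f : form n m) : V -> m.-tuple V -> Prop :=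
  match f in form _ m return V -> m.-tuple V -> Prop with
  | fEq _ i j => fun p s => fE p (tnth s i) (tnth s j)
  | fMem _ i j => fun p s => force_mem p (tnth s i) (tnth s j)
  | fPred _ k i => fun p s => force_mem p (tnth s i) (tnth Gamma k)
  | fNot _ g => fun p s => forall q, q ∈ M -> leq_in le q p -> ~ fstar Gamma g q s
  | fAnd _ g h => fun p s => fstar Gamma g p s /\ fstar Gamma h p s
  | fAll _ g => fun p s =>
      forall x, x ∈ M -> name x -> fstar Gamma g p [tuple of x :: s]
  end.

Lemma fstar_weaken n (Gamma : n.-tuple V) m (f : form n m) p q s :
  leq_in le q p -> fstar Gamma f p s -> fstar Gamma f q s.
Proof.
elim: f p q s => {m} /=.
- by move=> m i j p q s; apply: fE_weaken.
- by move=> m i j p q s qp H r rM rq; apply: H rM (leq_trans_P hP rq qp).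
- by move=> m k i p q s qp H r rM rq; apply: H rM (leq_trans_P hP rq qp).
- by move=> m f _ p q s qp H r rM rq; apply: H rM (leq_trans_P hP rq qp).
- by move=> m f IHf g IHg p q s qp [Hf Hg]; split; [apply: IHf qp Hf|apply: IHg qp Hg].
- by move=> m f IH p q s qp H x xM nx; apply: IH qp (H x xM nx).
Qed.

Lemma names_cons m x (s : m.-tuple V) : x ∈ M -> name x -> names_in M P s ->
  names_in M P [tuple of x :: s].
Proof.
by move=> xM nx ns i; case: (unliftP ord0 i) => [j ->|->]; rewrite ?tnthS ?tnth0.
Qed.

(** Used both to decide formulas densely and to pass from truth in all generic extensions back to
    [fstar]. *)
Lemma fstar_dense n (Gamma : n.-tuple V) m (f : form n m) p s :
  p ∈ fdom P -> names_in M P s ->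
  (forall q, leq_in le q p -> exists r, leq_in le r q /\ fstar Gamma f r s) ->
  fstar Gamma f p s.
Proof.
elim: f p s => {m} /=.
- move=> m i j p s pP ns H; have [_ nsi] := ns i; have [_ nsj] := ns j.
  exact: fE_dense H.
- by move=> m i j p s pP ns H; apply: force_mem_dense.
- by move=> m k i p s pP ns H; apply: force_mem_dense.
- move=> m f _ p s pP ns H q qM qp Hq; have [r [rq Hr]] := H q qp.
  have [rP _] := leq_cond hP rq; have [_ _ po] := hP.
  apply: (Hr r (cond_M hM hP rP) (po_refl po rP)).
  exact: fstar_weaken rq Hq.
- move=> m f IHf g IHg p s pP ns H; split; [apply: IHf|apply: IHg] => // q qp;
    by have [r [rq [Hf Hg]]] := H q qp; exists r.
- move=> m f IH p s pP ns H x xM nx; apply: (IH _ _ pP (names_cons xM nx ns)) => q qp.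
  by have [r [rq Hr]] := H q qp; exists r; split; [exact: rq|exact: Hr].
Qed.

Lemma dfn_force_mem : dfn M C (fun r => force_mem (r 0) (r 1) (r 2)).
Proof.
have [DC lC po] := hP; have Fd s t u := @dfn_sub3 _ _ fE s t u hE.
by rewrite /force_mem /mem_step /mem_at; dfn_tac_with ltac:(apply: Fd).
Qed.

Lemma dfn_force_mem_class X : X ∈ C -> dfn M C (fun r => force_mem (r 0) (r 1) X).
Proof.
move=> XC; have [DC lC po] := hP; have Fd s t u := @dfn_sub3 _ _ fE s t u hE.
by rewrite /force_mem /mem_step /mem_at; dfn_tac_with ltac:(apply: Fd).
Qed.

(** Arbitrary terms in the argument places let the induction pass quantifiers, where a new variable
    enters at index 0 and the old ones are shifted. *)
Lemma dfn_fstar n (Gamma : n.-tuple V) m (f : form n m) : all_in Gamma C ->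
  forall (p : env -> V) (t : 'I_m -> env -> V),
  dterm M C p -> (forall i, dterm M C (t i)) ->
  dfn M C (fun r => fstar Gamma f (p r) [tuple t i r | i < m]).
Proof.
have [DC lC po] := hP; move=> GC.
elim: f => {m} [m i j|m i j|m k i|m f IH|m f IHf g IHg|m f IH] p t pd td /=.
- apply: (dfn_ext (Q := fun r => fE (p r) (t i r) (t j r))).
    by move=> r _; rewrite !tnth_mktuple.
  exact: (dfn_sub3 hE).
- apply: (dfn_ext (Q := fun r => force_mem (p r) (t i r) (t j r))).
    by move=> r _; rewrite !tnth_mktuple.
  exact: (dfn_sub3 dfn_force_mem).
- apply: (dfn_ext (Q := fun r => force_mem (p r) (t i r) (tnth Gamma k))).
    by move=> r _; rewrite !tnth_mktuple.
  exact: (@dfn_sub2 _ _ (fun x y => force_mem x y (tnth Gamma k)) _ _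
    (dfn_force_mem_class (GC k))).
- apply: dfn_all; apply: dfn_imp.
    by apply: dfn_leq_class => //; [apply: dterm_var|apply: (@dterm_ren _ _ S)].
  apply: dfn_not; apply: IH; first exact: dterm_var.
  by move=> i; apply: (@dterm_ren _ _ S).
- by apply: dfn_and; [apply: IHf|apply: IHg].
- apply: dfn_all; apply: dfn_imp.
    by apply: (dfn_sub1 (dfn_is_name hM DC)); apply: dterm_var.
  pose t' (i : 'I_m.+1) (r : env) :=
    if unlift ord0 i is Some j then t j (fun k => r k.+1) else r 0.
  apply: (dfn_ext _ (IH (fun r => p (fun k => r k.+1)) t' _ _)).
  + move=> r _; suff -> : [tuple t' i r | i < m.+1] =
        [tuple of r 0 :: [tuple t i (fun k => r k.+1) | i < m]] by [].
    apply: eq_from_tnth => i; rewrite tnth_mktuple /t'.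
    by case: unliftP => [j ->|->]; rewrite ?tnthS ?tnth0 ?tnth_mktuple.
  + exact: (@dterm_ren _ _ S).
  + move=> i; rewrite /t'; case: unlift => [j|]; last exact: dterm_var.
    exact: (@dterm_ren _ _ S).
Qed.

Lemma dfn_fstar_const n (Gamma : n.-tuple V) m (f : form n m) s :
  names_in C P Gamma -> names_in M P s -> dfn M C (fun r => fstar Gamma f (r 0) s).
Proof.
move=> nG ns; have GC : all_in Gamma C by move=> k; case: (nG k).
apply: (dfn_ext _ (@dfn_fstar _ _ _ f GC (fun r => r 0) (fun i _ => tnth s i) _ _)).
- move=> r _; suff -> : [tuple tnth s i | i < m] = s by [].
  by apply: eq_from_tnth => i; rewrite tnth_mktuple.
- exact: dterm_var.
- by move=> i; apply: (dterm_const hM); case: (ns i).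
Qed.

(** At a negation or a quantifier, [G] contains a condition deciding the matter; for a universal
    formula this means forcing it or forcing a counterexample at some name. *)
Lemma fstar_truth G n (Gamma : n.-tuple V) m (f : form n m) s :
  generic C P G -> names_in C P Gamma -> names_in M P s ->
  sat_ext M P G Gamma f s <-> exists p, p ∈ G /\ fstar Gamma f p s.
Proof.
move=> gG nG; have [[GP [p0 p0G] Gup Gdir] _] := gG; have [_ _ po] := hP.
have GM p : p ∈ G -> p ∈ M by move=> /GP; apply: cond_M hM hP _.
have GCd m' (g : form n m') t : names_in M P t -> dfn M C (fun r => fstar Gamma g (r 0) t).
  exact: dfn_fstar_const.
have nofstar m' (g : form n m') p t : p ∈ fdom P -> names_in M P t -> ~ fstar Gamma g p t ->
    exists q, leq_in le q p /\ fstar Gamma (fNot g) q t.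
  move=> pP nt nf; apply: contrapT => H; apply: nf; apply: (fstar_dense pP nt) => q qp.
  apply: contrapT => K; apply: H; exists q; split; first exact: qp.
  by move=> r rM rq Hr; apply: K; exists r.
rewrite /sat_ext; elim: f s => {m} [m i j|m i j|m k i|m f IH|m f IHf g IHg|m f IH] s ns /=.
- rewrite !tnth_map; have [siM nsi] := ns i; have [sjM nsj] := ns j; split=> [E|[p [pG H]]].
    exact: fE_of_val_eq E.
  exact: val_eq_of_fE H.
- rewrite !tnth_map; have [siM nsi] := ns i; have [sjM nsj] := ns j.
  exact: force_mem_truth gG siM (set_class sjM) nsi nsj.
- rewrite !tnth_map; have [siM nsi] := ns i; have [GkC nGk] := nG k.
  exact: force_mem_truth gG siM GkC nsi nGk.
- rewrite IH //; split=> [H|[p [pG H]] [q [qG K]]]; last first.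
    have [r [rG rp rq]] := Gdir _ _ pG qG.
    by apply: (H r (GM _ rG) rp); apply: fstar_weaken rq K.
  have [||p [pG [Hp|Hp]]] := generic_below
    (Q := fun p => fstar Gamma f p s \/ fstar Gamma (fNot f) p s) gG p0G.
  + by apply: dfn_or; apply: GCd.
  + move=> q qp; have [qP _] := leq_cond hP qp.
    have [h|/(nofstar _ _ _ _ qP ns) [r [rq h]]] := pselect (fstar Gamma f q s).
      by exists q; split; [exact: po_refl po _ qP|left].
    by exists r; split; [exact: rq|right].
  + by case: H; exists p.
  + by exists p.
- rewrite IHf // IHg //; split=> [[[p [pG Hp]] [q [qG Hq]]]|[p [pG [Hf Hg]]]].
    have [r [rG rp rq]] := Gdir _ _ pG qG; exists r; split; first exact: rG.
    by split; [apply: fstar_weaken rp Hp|apply: fstar_weaken rq Hq].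
  by split; exists p.
- have satE x : sat (gen_ext M P G) (map_tuple (val G) Gamma) f
      [tuple of val G x :: map_tuple (val G) s] <->
    sat (gen_ext M P G) (map_tuple (val G) Gamma) f (map_tuple (val G) [tuple of x :: s]).
    apply: sat_ext_eq => // i; rewrite tnth_map.
    by case: (unliftP ord0 i) => [j ->|->]; rewrite ?tnthS ?tnth0 ?tnth_map.
  split=> [H|[p [pG Hp]] _ /in_image [x [/in_sep [xM nx] ->]]]; last first.
    apply/satE/IH; first exact: names_cons.
    by exists p; split; [exact: pG|exact: Hp].
  have [||p [pG [Hp|[x [xM [nx Hp]]]]]] := generic_below
    (Q := fun p => fstar Gamma (fAll f) p s \/
      exists x, x ∈ M /\ (name x /\ fstar Gamma (fNot f) p [tuple of x :: s])) gG p0G.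
  + apply: dfn_or; first exact: GCd.
    apply: dfn_ex; apply: dfn_and.
      by have [DC _ _] := hP; apply: (dfn_sub1 (dfn_is_name hM DC)); apply: dterm_var.
    have GC : all_in Gamma C by move=> k; case: (nG k).
    (* Variable 0 is the quantified name, so the condition sits at variable 1. *)
    pose t' (i : 'I_m.+1) (r : env) := if unlift ord0 i is Some j then tnth s j else r 0.
    apply: (dfn_ext _ (dfn_fstar (p := fun r => r 1) (t := t') (fNot f) GC _ _)).
    * move=> r _; suff -> : [tuple t' i r | i < m.+1] = [tuple of r 0 :: s] by [].
      apply: eq_from_tnth => i; rewrite tnth_mktuple /t'.
      by case: unliftP => [j ->|->]; rewrite ?tnthS ?tnth0.
    * exact: dterm_var.
    * move=> i; rewrite /t'; case: unlift => [j|]; last exact: dterm_var.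
      by apply: (dterm_const hM); case: (ns j).
  + move=> q qp; have [qP _] := leq_cond hP qp.
    have [h|h] := pselect (exists x, x ∈ M /\ (name x /\ ~ fstar Gamma f q [tuple of x :: s])).
      have [x [xM [nx nf]]] := h.
      have [r [rq Hr]] := nofstar _ _ _ _ qP (names_cons xM nx ns) nf.
      by exists r; split; [exact: rq|right; exists x].
    exists q; split; first exact: po_refl po _ qP.
    left=> x xM nx; apply: contrapT => nf; apply: h.
    by exists x; split; [exact: xM|split; [exact: nx|exact: nf]].
  + by exists p.
  + have /satE/(IH _ (names_cons xM nx ns)) [q [qG Hq]] : sat (gen_ext M P G)
        (map_tuple (val G) Gamma) f [tuple of val G x :: map_tuple (val G) s].
      by apply: H; apply/in_image; exists x; split=> //; apply/in_sep.
    have [r [rG rp rq]] := Gdir _ _ pG qG.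
    by case: (Hp r (GM _ rG) rp); apply: fstar_weaken rq Hq.
Qed.

(** If [fstar] failed at [p], then by [fstar_dense] some [q] below [p] would have no extension
    satisfying it. Countability gives a generic filter through [q], and [fstar_truth] produces such
    an extension. *)
Lemma forces_fstar n (Gamma : n.-tuple V) m (f : form n m) p s :
  names_in C P Gamma -> names_in M P s -> p ∈ fdom P ->
  forces M C P Gamma p f s <-> fstar Gamma f p s.
Proof.
move=> nG ns pP; split=> H; last first.
  by move=> G gG pG; apply/(fstar_truth f gG nG ns); exists p.
apply: (fstar_dense pP ns) => q qp; apply: contrapT => K.
have [qP _] := leq_cond hP qp.
have [_ _ _ cC] := hM; have [G [gG qG]] := generic_exists cC hP qP.
have [[GP _ Gup Gdir] _] := gG; have pG := Gup _ _ qG pP qp.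
have /(fstar_truth f gG nG ns) [r [rG Hr]] := H G gG pG.
have [x [xG xq xr]] := Gdir _ _ qG rG; apply: K; exists x; split; first exact: xq.
exact: fstar_weaken xr Hr.
Qed.

Lemma dfn_forall_ord k (Q : 'I_k -> env -> Prop) : (forall i, dfn M C (Q i)) ->
  dfn M C (fun r => forall i, Q i r).
Proof.
elim: k Q => [|k IH] Q H; first by apply: dfn_ext (dfn_Prop M C True) => r _; split=> // _ [].
apply: dfn_ext (dfn_and (H ord0) (IH (fun i => Q (lift ord0 i)) (fun i => H _))) => r _.
split=> [[H0 HS] i|K]; last by split=> [|i]; apply: K.
by case: (unliftP ord0 i) => [j ->|->].
Qed.

Lemma dterm_tup m (t : 'I_m -> env -> V) p l : dterm M C p ->
  (forall i, dterm M C (t i)) ->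
  dterm M C (fun r => tup (p r) [seq t i r | i <- l]).
Proof.
move=> pd td; elim: l p pd => [|i l IH] p pd //=.
by apply: (dterm_opair hM) => //; apply: IH.
Qed.

Lemma forcing_theorem_of_dfn n m (f : form n m) : forcing_theorem M C P f.
Proof.
have [DC lC po] := hP; split=> [Gamma nG|Gamma s G nG ns gG]; last first.
  move=> /(fstar_truth f gG nG ns) [p [pG Hp]]; exists p; split=> //.
  by apply/forces_fstar => //; have [[GP _ _ _] _] := gG; apply: GP.
have GC : all_in Gamma C by move=> k; case: (nG k).
(* Variable 0 is the condition, variables 1 to [m] are the names, and [m.+1] is the coded tuple, the
   only one left free once [dfn_exn] binds the others. *)
pose Q (r : env) := r 0 ∈ fdom P /\ ((forall i : 'I_m, name (r i.+1)) /\
  (fstar Gamma f (r 0) [tuple r i.+1 | i < m] /\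
   r m.+1 = tup (r 0) [tuple r i.+1 | i < m])).
have Qd : dfn M C Q.
  apply: dfn_and; first by apply: dfn_cls => //; apply: dterm_var.
  apply: dfn_and.
    by apply: dfn_forall_ord => i; apply: (dfn_sub1 (dfn_is_name hM DC)); apply: dterm_var.
  apply: dfn_and.
    by apply: (@dfn_fstar _ _ _ _ GC (fun r => r 0) (fun i r => r i.+1));
      [|move=> i]; apply: dterm_var.
  apply: dfn_eq; first exact: dterm_var.
  by apply: (@dterm_tup _ (fun i r => r i.+1) (fun r => r 0)) => [|i]; apply: dterm_var.
(* Closure of [M] under tuples is read off [dterm_tup] for constant terms. *)
have tupM p (s : m.-tuple V) : p ∈ M -> all_in s M -> tup p s ∈ M.
  move=> pM sM; have [x0 x0M] := M_inhabited hM.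
  have [+ _] := @dterm_tup _ (fun i _ => tnth s i) (fun=> p) (ord_tuple m)
    (dterm_const hM pM) (fun i => dterm_const hM (sM i)).
  move=> /(_ (fun=> x0) (fun=> x0M)); rewrite (_ : [seq _ | _ <- _] = s) //.
  exact: (map_tnth_enum s).
apply: (compr hM); last first.
  move=> z [p [s [pP ns _ ->]]]; apply: tupM; first exact: (cond_M hM hP).
  by move=> i; case: (ns i).
apply: dfn_ext (dfn_exn m.+1 Qd) => r rM; rewrite /Q ltnS ltnn subnn /=; split.
  move=> [e [eM [pP [nE [Hf zE]]]]].
  have E : [tuple if i.+1 < m.+1 then e i.+1 else r (i.+1 - m.+1) | i < m] =
      [tuple e i.+1 | i < m].
    by apply: eq_from_tnth => i; rewrite !tnth_mktuple ltnS ltn_ord.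
  rewrite E in Hf; exists (e 0), [tuple e i.+1 | i < m].
  have ns : names_in M P [tuple e i.+1 | i < m].
    move=> i; rewrite tnth_mktuple; split; first exact: eM.
    by have := nE i; rewrite ltnS ltn_ord.
  split; [exact: pP|exact: ns|exact/(forces_fstar f nG ns pP)|].
  exact: etrans zE (congr1 (fun u : m.-tuple V => tup (e 0) u) E).
move=> [p [s [pP ns Hf zE]]].
have pM := cond_M hM hP pP.
(* Positions beyond [m] take the default [p], so that the whole environment stays in [M]. *)
pose e i := if i is j.+1 then nth p s j else p.
have eE (i : 'I_m) : e i.+1 = tnth s i by rewrite (tnth_nth p).
exists e; split.
  move=> [|i] //=; have [lt|le] := ltnP i m; last by rewrite nth_default ?size_tuple.
  by have [] := ns (Ordinal lt); rewrite (tnth_nth p).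
have E : [tuple if i.+1 < m.+1 then e i.+1 else r (i.+1 - m.+1) | i < m] = s.
  by apply: eq_from_tnth => i; rewrite tnth_mktuple ltnS ltn_ord eE.
rewrite E; split; first exact: pP.
split; first by move=> i; rewrite ltnS ltn_ord eE; case: (ns i).
split; first exact/(forces_fstar f nG ns pP).
exact: etrans zE (esym (congr1 (fun u : m.-tuple V => tup p u) E)).
Qed.

End ForcingTheorem.

Theorem theorem6p4 (M C : V) (P : forcing)
    (hM : ctm_GBm M C) (hP : class_forcing C P)
    (hproj : approachable_by_projections M C P) :
  class_in C (fun z => exists p s t,
    [/\ p ∈ fdom P, name_in M P s, name_in M P t,
        forces M C P [tuple] p eq_formula [tuple s; t] &
        z = tup p [:: s; t]]) /\
  (forall (n m : nat) (f : form n m), forcing_theorem M C P f).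
Proof.
have FT n m (f : form n m) : forcing_theorem M C P f.
  exact: forcing_theorem_of_dfn hM hP (dfn_proper_force_eq hM hP hproj) _ _ f.
(* The first claim is the definability lemma for equality without predicates, up to writing a tuple
   of length two by its entries. *)
split=> //; have [|X [XC XE]] := (FT _ _ eq_formula).1 [tuple]; first by case.
exists X; split=> // z; rewrite XE; split=> [[p [s [pP ns Hf zE]]]|[p [s [t [pP ns nt Hf zE]]]]].
  have sE : s = [tuple tnth s ord0; tnth s ord_max].
    apply: eq_from_tnth => i; case: (unliftP ord0 i) => [j ->|-> //].
    by rewrite (ord1 j) tnthS; congr tnth; apply: val_inj.
  exists p, (tnth s ord0), (tnth s ord_max); rewrite -sE.
  by split=> //; rewrite zE {1}sE.
exists p, [tuple s; t]; split; [exact: pP| |exact: Hf|exact: zE].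
by move=> i; case: (unliftP ord0 i) => [j ->|->]; [rewrite (ord1 j)|].
Qed.
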